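(* For any partition $\lambda$, the normalized Schur polynomial $\mathrm{N}(s_{\lambda}(x_1,\ldots,x_m))$ is Lorentzian.
   Context: For a partition $\lambda$ (a weakly decreasing sequence of nonnegative integers), the Schur polynomial in $m$ variables is $s_\lambda(x_1,\ldots,x_m)=\sum_{\mathrm{T}} x^{\mu(\mathrm{T})}=\sum_\mu K_{\lambda\mu}x^\mu$, where the sum is over Young tableaux $\mathrm{T}$ of shape $\lambda$ with entries from $[m]$, $\mu_i(\mathrm{T})$ is the number of $i$'s in $\mathrm{T}$, and $K_{\lambda\mu}$ is the Kostka number. The linear operator $\mathrm{N}$ is defined by $\mathrm{N}(x^\mu)=\frac{x^\mu}{\mu!}=\frac{x_1^{\mu_1}}{\mu_1!}\cdots\frac{x_m^{\mu_m}}{\mu_m!}$ for all $\mu\in\mathbb{N}^m$. A subset $\mathrm{J}\subseteq\mathbb{Z}^n$ is $\mathrm{M}$-convex if for any $i\in[n]$ and any $\alpha,\beta\in\mathrm{J}$ with $\alpha_i>\beta_i$ there is $j\in[n]$ with $\alpha_j<\beta_j$, $\alpha-e_i+e_j\in\mathrm{J}$ and $\beta-e_j+e_i\in\mathrm{J}$. A homogeneous polynomial $h(x_1,\ldots,x_n)$ of degree $d$ is Lorentzian if all its coefficients are nonnegative, its support (set of exponent vectors of monomials appearing, as a subset of $\mathbb{N}^n$) is $\mathrm{M}$-convex, and for any $i_1,\ldots,i_{d-2}\in[n]$ the quadratic form $\frac{\partial}{\partial x_{i_1}}\cdots\frac{\partial}{\partial x_{i_{d-2}}}h$ has at most one positive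 eigenvalue (equivalently, $h$ is a limit of strictly Lorentzian polynomials, or $h$ has nonnegative coefficients and $h$ and all its partial derivatives are identically zero or log-concave on $\mathbb{R}^n_{>0}$). *)

(* Defs.v *)
From HB Require Import structures.
From mathcomp Require Import all_boot all_order all_algebra.
From mathcomp Require Import mpoly polyrcf.
From mathcomp Require Import reals.

Set Implicit Arguments.
Unset Strict Implicit.
Unset Printing Implicit Defensive.

Import Order.TTheory GRing.Theory Num.Theory.
Local Open Scope ring_scope.

(** Partitions are finite sequences, trailing zeros being allowed. *)
Definition is_partition (la : seq nat) : bool := sorted geq la.

(** Boxes of the Young diagram, in English notation and 0-indexed: the
    dependent pair of a row [i < size la] and a column [j < la_i]. *)
Definition box (la : seq nat) : finType := {i : 'I_(size la) & 'I_(nth 0%N la i)}.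
Definition box_row (la : seq nat) (c : box la) : nat := tag c.
Definition box_col (la : seq nat) (c : box la) : nat := tagged c.

(** Young tableaux are the semistandard ones: the entries weakly increase along
    the rows and strictly increase down the columns. *)
Definition is_tableau (la : seq nat) (m : nat) (T : {ffun box la -> 'I_m}) : bool :=
  [forall c : box la, forall c' : box la,
     (((box_row c == box_row c') && (box_col c < box_col c')%N) ==> (T c <= T c')%N)
  && (((box_col c == box_col c') && (box_row c < box_row c')%N) ==> (T c < T c')%N)].

Definition tableau_weight (la : seq nat) (m : nat) (T : {ffun box la -> 'I_m}) :
    'X_{1..m} :=
  [multinom #|[set c : box la | T c == i]| | i < m].

Definition schur (R : realType) (m : nat) (la : seq nat) : {mpoly R[m]} :=
  \sum_(T : {ffun box la -> 'I_m} | is_tableau T) 'X_[tableau_weight T].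

Definition mnm_fact (m : nat) (mu : 'X_{1..m}) : nat := (\prod_(i < m) (mu i)`!)%N.

Definition normalize (R : realType) (m : nat) (p : {mpoly R[m]}) : {mpoly R[m]} :=
  \sum_(mu <- msupp p) (p@_mu / (mnm_fact mu)%:R) *: 'X_[mu].

Lemma mcoeff_normalize (R : realType) (m : nat) (p : {mpoly R[m]}) (mu : 'X_{1..m}) :
  (normalize p)@_mu = p@_mu / (mnm_fact mu)%:R.
Proof.
rewrite /normalize raddf_sum /=; case: (boolP (mu \in msupp p)) => [mu_p | muNp].
  rewrite (bigD1_seq mu) ?msupp_uniq //= mcoeffZ mcoeffX eqxx mulr1.
  rewrite big1 ?addr0 // => nu /negPf nu_mu.
  by rewrite mcoeffZ mcoeffX nu_mu mulr0.
rewrite (memN_msupp_eq0 muNp) mul0r big1_seq // => nu /andP[_ nu_p].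
rewrite mcoeffZ mcoeffX; case: eqP => [nu_mu | _]; last by rewrite mulr0.
by rewrite -nu_mu nu_p in muNp.
Qed.

Lemma normalize_is_linear (R : realType) (m : nat) : linear (@normalize R m).
Proof.
move=> a p q; apply/mpolyP => mu.
by rewrite mcoeffD mcoeffZ !mcoeff_normalize mcoeffD mcoeffZ mulrDl mulrA.
Qed.

HB.instance Definition _ (R : realType) (m : nat) :=
  GRing.isLinear.Build R {mpoly R[m]} {mpoly R[m]} *:%R (@normalize R m)
    (@normalize_is_linear R m).

Lemma normalizeX (R : realType) (m : nat) (mu : 'X_{1..m}) :
  normalize ('X_[mu] : {mpoly R[m]}) = (mnm_fact mu)%:R^-1 *: 'X_[mu].
Proof. by rewrite /normalize msuppX big_seq1 mcoeffX eqxx mul1r. Qed.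

Definition unit_vec (n : nat) (i : 'I_n) : 'rV[int]_n := delta_mx 0 i.

Definition M_convex (n : nat) (J : 'rV[int]_n -> Prop) : Prop :=
  forall (i : 'I_n) (a b : 'rV[int]_n), J a -> J b -> b 0 i < a 0 i ->
  exists j : 'I_n, [/\ a 0 j < b 0 j,
    J (a - unit_vec i + unit_vec j) & J (b - unit_vec j + unit_vec i)].

(** The support in [N^n], viewed inside [Z^n]. *)
Definition support_set (R : realType) (n : nat) (h : {mpoly R[n]}) :
    'rV[int]_n -> Prop :=
  fun a => exists2 mu : 'X_{1..n}, mu \in msupp h & a = \row_i (mu i)%:Z.

(** The symmetric matrix [A] with [q(x) = x A x^T] when [q] is a quadratic form:
    half the (constant) Hessian of [q]. *)
Definition form_matrix (R : realType) (n : nat) (q : {mpoly R[n]}) : 'M[R]_n :=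
  \matrix_(i, j) ((q^`M(i))^`M(j)@_0%MM / 2%:R).

(** The number of positive eigenvalues, counted with multiplicity. *)
Definition num_pos_eigenvalues (R : realType) (n : nat) (A : 'M[R]_n) : nat :=
  (\sum_(a <- rootsR (char_poly A) | (0 < a)%R) mup a (char_poly A))%N.

Definition iter_deriv (R : realType) (n : nat) (s : seq 'I_n) (h : {mpoly R[n]}) :
    {mpoly R[n]} :=
  foldr (fun i q => q^`M(i)) h s.

(** The degree [d] is a parameter because the zero polynomial, which is
    Lorentzian, is homogeneous of every degree.  For [d < 2] there is no
    quadratic derivative, and the eigenvalue condition is void. *)
Definition lorentzian (R : realType) (n d : nat) (h : {mpoly R[n]}) : Prop :=
  [/\ h \is d.-homog,
      forall mu : 'X_{1..n}, 0 <= h@_mu,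
      M_convex (support_set h) &
      forall s : seq 'I_n, (size s).+2 = d ->
        (num_pos_eigenvalues (form_matrix (iter_deriv s h)) <= 1)%N].

(* Main.v *)
Require Import Defs.
From HB Require Import structures.
From mathcomp Require Import all_boot all_order all_algebra.
From mathcomp Require Import mpoly polyrcf.
From mathcomp Require Import reals.
From mathcomp Require Import all_fingroup.
From mathcomp Require Import ring lra zify.

(** Let [u = la + (N, ..., 1, 0)], and let [Phi_u g] be the coefficient of [y^u] in [g]
    times the Vandermonde polynomial in [y_0, ..., y_N]. By Pieri's rule, adjoining
    variables [eta_l] one at a time, each with a divided difference over all the
    nodes [y_i], extends [Phi_u] to a functional whose value at the product of the
    [eta_l ^ (mu_l + N)] is the Kostka number [K_{la,mu}]. This functional plays the
    role of integration over a tower of projective bundles, and it obeys a Hodge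
    index inequality: [T (x x) T (z z) <= T (x z)^2] whenever [T (x x) > 0], for [T g = Phi_u (h_1 ... h_d g)]
    with [h_i] in a suitable cone. The inequality is proved by the Bochner method: if
    multiplication by [h_1] splits [T] into functionals of smaller degree that already
    satisfy it, solving a weighted Laplace equation on the index set of the pieces
    gives it for [T]. Adjoining a variable preserves the inequality, and letting
    the [h_i] tend to the [eta_l] bounds the positive eigenvalues of the matrices
    [K_{la,nu+e_i+e_j}], which are, up to a factor, the second derivatives.

    The support consists of the integer points of the base polytope of the submodular
    function [S |-> la_1 + ... + la_#|S|], and the exchange property follows by
    comparing tight sets. *)

Set Implicit Arguments.
Unset Strict Implicit.
Unset Printing Implicit Defensive.
Import Order.TTheory GRing.Theory Num.Theory.
Local Open Scope ring_scope.

(** * Forms with at most one positive direction *)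

Section Bochner.
Variable R : realFieldType.

(** In the Bochner step one class has two roles: [h_1] is a factor of the functional, and the form
    is shown nonpositive on the orthogonal complement of that same [h_1]. If [h_1] is a sum of
    pieces [xi_j], pairing [x] with [h_1] in the functional where [xi_j] replaces [h_1] is the same
    as pairing [x] with [xi_j] in the original one; this symmetry closes the induction. The obstacle
    is a row [r] with [u_r = u_{r+1} + 1]. Antisymmetry makes [y_r] annihilate the classes fixed by
    exchanging [y_r] and [y_{r+1}], but not the others, so the piece [y_r] is neither zero nor
    positive. The argument is therefore run on the fixed classes, and [y_r], which is orthogonal to
    them, is treated by hand: lowering row [r] twice and exchanging the two rows shows that its
    square is nonpositive. Exponents are shifted by [N] because a divided difference at [N + 1]
    nodes lowers the degree by [N]. The passage to the limit works over any ordered field, since all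
    values are polynomials in the perturbation parameter. *)

Lemma laplacian_form n (M : 'M[R]_n) (s : 'I_n -> R) :
  (forall i j, M i j = M j i) ->
  \sum_i s i * (\sum_j M i j * s j - (\sum_j M i j) * s i) *+ 2 =
  - \sum_i \sum_j M i j * (s i - s j) ^+ 2.
Proof.
move=> symM.
have E1 : \sum_i \sum_j M i j * (s i - s j) ^+ 2 =
  (\sum_i \sum_j M i j * s i ^+ 2 + \sum_i \sum_j M i j * s j ^+ 2)
  - \sum_i \sum_j (M i j * s i * s j) *+ 2.
  rewrite -big_split -sumrB /=; apply: eq_bigr => i _.
  rewrite -big_split -sumrB /=; apply: eq_bigr => j _.
  by rewrite mulr2n; ring.
have E2 : \sum_i \sum_j M i j * s j ^+ 2 = \sum_i \sum_j M i j * s i ^+ 2.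
  rewrite exchange_big /=; apply: eq_bigr => i _; apply: eq_bigr => j _.
  by rewrite symM.
rewrite E1 E2; transitivity (\sum_i \sum_j (M i j * s i * s j - M i j * s i ^+ 2) *+ 2).
  apply: eq_bigr => i _; rewrite mulr_suml -sumrB mulr_sumr -sumrMnl.
  by apply: eq_bigr => j _; rewrite !mulr2n; ring.
under eq_bigr => i _ do (under eq_bigr => j _ do rewrite mulrnBl; rewrite sumrB).
rewrite sumrB opprB -mulr2n; congr (_ - _).
by rewrite -sumrMnl; apply: eq_bigr => i _; rewrite -sumrMnl.
Qed.

(** The range of a symmetric matrix is the annihilator of its kernel. By [laplacian_form] a kernel
    vector is constant on [J], where all weights are positive, so it is orthogonal to any [w]
    supported on [J] with sum zero. *)
Lemma laplacian_solve n (M : 'M[R]_n) (J : pred 'I_n) (w : 'I_n -> R) :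
  (forall i j, M i j = M j i) ->
  (forall i j, i != j -> 0 <= M i j) ->
  (forall i j, J i -> J j -> i != j -> 0 < M i j) ->
  (forall i, ~~ J i -> w i = 0) ->
  \sum_i w i = 0 ->
  exists s : 'I_n -> R, forall i, \sum_j M i j * s j - (\sum_j M i j) * s i = w i.
Proof.
move=> symM M_ge0 M_gt0 w0 sumw.
pose L : 'M[R]_n := \matrix_(i, j) (M i j - (i == j)%:R * \sum_k M i k).
have LE (s : 'I_n -> R) i :
    \sum_j L i j * s j = \sum_j M i j * s j - (\sum_j M i j) * s i.
  under eq_bigr => j _ do rewrite mxE mulrBl.
  rewrite sumrB; congr (_ - _); rewrite (bigD1 i) //= eqxx mul1r [X in _ + X]big1 ?addr0 //.
  by move=> j /negPf; rewrite eq_sym => ->; rewrite !mul0r.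
have ker (z : 'I_n -> R) : (forall i, \sum_j L i j * z j = 0) -> \sum_i w i * z i = 0.
  move=> Lz.
  have S0 : \sum_i \sum_j M i j * (z i - z j) ^+ 2 = 0.
    apply: oppr_inj; rewrite oppr0 -laplacian_form //.
    by rewrite big1 // => i _; rewrite -LE Lz mulr0 mul0rn.
  have ge i j : 0 <= M i j * (z i - z j) ^+ 2.
    have [->|ij] := eqVneq i j; first by rewrite subrr expr0n mulr0.
    by rewrite mulr_ge0 ?M_ge0 ?sqr_ge0.
  have zJ i j : J i -> J j -> z i = z j.
    move=> Ji Jj; have [->//|ij] := eqVneq i j.
    have /psumr_eq0P S0' := S0.
    have := S0' (fun i _ => sumr_ge0 _ (fun j _ => ge i j)) i isT.
    move/(psumr_eq0P (fun j _ => ge i j))/(_ j isT)/eqP.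
    by rewrite mulf_eq0 gt_eqF ?M_gt0 //= sqrf_eq0 subr_eq0 => /eqP.
  have [i0 Ji0|noJ] := pickP J; last by rewrite big1 // => i _; rewrite w0 ?noJ ?mul0r.
  rewrite (eq_bigr (fun i => w i * z i0)) -?mulr_suml ?sumw ?mul0r // => i _.
  by have [Ji|/w0->] := boolP (J i); [rewrite (zJ i i0)|rewrite !mul0r].
pose wr : 'rV[R]_n := \row_i w i.
have symL i j : L i j = L j i.
  by rewrite !mxE symM eq_sym; case: eqVneq => [->|] //; rewrite !mul0r.
have : (wr <= L)%MS.
  rewrite submxE; apply/eqP/rowP => j; rewrite mxE [RHS]mxE.
  rewrite (eq_bigr (fun i => w i * cokermx L i j)); last by move=> i _; rewrite mxE.
  apply: ker => i; have /matrixP/(_ i j) := mulmx_coker L.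
  by rewrite mxE [RHS]mxE.
move=> /submxP[sr /rowP sE]; exists (fun i => sr 0 i) => i.
rewrite -LE; have := sE i; rewrite mxE [RHS]mxE => ->.
by apply: eq_bigr => j _; rewrite symL mulrC.
Qed.

(** The numerical content of [bochner]: [q], [w] and [M] stand for the values of [T] at [x * x],
    [x * xi j] and [xi i * xi j], and the last hypothesis bounds the form at [x - \sum_j s j * xi j]
    for every [s]. *)
Lemma bochner_num n (M : 'M[R]_n) (J : pred 'I_n) (w : 'I_n -> R) (q : R) :
  (forall i j, M i j = M j i) ->
  (forall i j, i != j -> 0 <= M i j) ->
  (forall i j, J i -> J j -> i != j -> 0 < M i j) ->
  (forall i, ~~ J i -> w i = 0) ->
  \sum_i w i = 0 ->
  (forall s : 'I_n -> R,
    q - (\sum_j s j * w j) *+ 2 + \sum_i s i * \sum_j M i j * s j <=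
    \sum_i (w i - \sum_j M i j * s j) ^+ 2 / \sum_j M i j) ->
  q <= 0.
Proof.
move=> symM M_ge0 M_gt0 w0 sumw H.
(* With this choice of [s] the hypothesis becomes [q <= s L s] for the Laplacian [L]
   of the weights [M], which is negative semidefinite. *)
have [s sE] := laplacian_solve symM M_ge0 M_gt0 w0 sumw.
have := H s; set p := fun i => \sum_j M i j.
have -> : \sum_i (w i - \sum_j M i j * s j) ^+ 2 / p i = \sum_i p i * s i ^+ 2.
  apply: eq_bigr => i _; rewrite -sE.
  have -> : \sum_j M i j * s j - (\sum_j M i j) * s i - \sum_j M i j * s j = - (p i * s i).
    by rewrite /p; ring.
  (* A zero row sum is harmless: the numerator vanishes with it. *)
  have [->|pn0] := eqVneq (p i) 0; first by rewrite !mul0r oppr0 expr0n mul0r.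
  by rewrite sqrrN; field.
have S_ge0 : 0 <= \sum_i \sum_j M i j * (s i - s j) ^+ 2.
  apply: sumr_ge0 => i _; apply: sumr_ge0 => j _.
  have [->|ij] := eqVneq i j; first by rewrite subrr expr0n mulr0.
  by rewrite mulr_ge0 ?M_ge0 ?sqr_ge0.
have := laplacian_form s symM; rewrite sumrMnl => S_le0.
have E : \sum_i s i * (\sum_j M i j * s j - (\sum_j M i j) * s i) =
  \sum_i s i * (\sum_j M i j * s j) - \sum_i p i * s i ^+ 2.
  by rewrite -sumrB; apply: eq_bigr => i _; rewrite /p; ring.
have -> : \sum_i s i * w i =
  \sum_i s i * (\sum_j M i j * s j) - \sum_i p i * s i ^+ 2.
  by rewrite -sumrB; apply: eq_bigr => i _; rewrite -sE /p; ring.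
by move: S_le0; rewrite E !mulr2n; lra.
Qed.
End Bochner.

Section HodgeForms.
Variables (R : realFieldType) (B : comNzRingType) (io : {rmorphism R -> B}).

(** Linearity is expressed through [io], so that it keeps its meaning when [B] is replaced by
    [{poly B}]. *)
Definition functional (T : B -> R) :=
  (forall a b, T (a + b) = T a + T b) /\ (forall c g, T (io c * g) = c * T g).

Definition subspace (V : B -> Prop) := forall x z c, V x -> V z -> V (x + io c * z).

(** The reverse Cauchy-Schwarz inequality: on a subspace [V] it says that the form has no positive
    definite plane. *)
Definition hodge (V : B -> Prop) (T : B -> R) := forall x y, V x -> V y ->
  0 < T (x * x) -> T (x * x) * T (y * y) <= T (x * y) ^+ 2.

Lemma functional0 T : functional T -> T 0 = 0.
Proof. by case=> [_ /(_ 0 0)]; rewrite rmorph0 !mul0r. Qed.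

Lemma functional_sum T : functional T -> forall I (r : seq I) (P : pred I) F,
  T (\sum_(i <- r | P i) F i) = \sum_(i <- r | P i) T (F i).
Proof. by move=> fT I r P F; apply: big_morph; [apply: fT.1|apply: functional0]. Qed.

Lemma functional_mul T p : functional T -> functional (fun g => T (p * g)).
Proof. by case=> TD TZ; split=> [a b|c g]; rewrite ?mulrDr ?TD // mulrCA TZ. Qed.

Lemma functional_scale T c : functional T -> functional (fun g => c * T g).
Proof. by case=> TD TZ; split=> [a b|d g]; rewrite ?TD ?TZ ?mulrDr // mulrCA. Qed.

(** Subtracting from [y] the multiple of [x] that makes it orthogonal to [D] gives a vector of
    nonpositive square; multiplying by [T (x * x)] and completing the square yields the
    inequality. *)
Lemma hodge_orth V T D : functional T -> subspace V ->
  (forall x, V x -> T (x * D) = 0 -> T (x * x) <= 0) -> hodge V T.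
Proof.
move=> fT subV neg x y Vx Vy xx_gt0.
have [xD|xD] := eqVneq (T (x * D)) 0; first by have := neg _ Vx xD; rewrite leNgt xx_gt0.
set t := T (y * D) / T (x * D).
have := neg (y + io (- t) * x) (subV _ _ _ Vy Vx).
have [TD TZ] := fT.
have -> : T ((y + io (- t) * x) * D) = 0.
  by rewrite mulrDl -mulrA TD TZ /t; field.
have -> : (y + io (- t) * x) * (y + io (- t) * x) =
  y * y + io (- t) * (x * y) + io (- t) * (x * y) + io (- t) * (io (- t) * (x * x)) by ring.
rewrite !TD !TZ => /(_ erefl) H.
have : T (x * x) * (T (y * y) - t * T (x * y) *+ 2 + t ^+ 2 * T (x * x)) <= 0.
  by rewrite pmulr_rle0 //; move: H; rewrite mulr2n; lra.
have : 0 <= (t * T (x * x) - T (x * y)) ^+ 2 by apply: sqr_ge0.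
by rewrite mulr2n !expr2; lra.
Qed.

(** On an isotropic space plus a line, the difference of the two sides of the inequality is itself a
    square. *)
Lemma hodge_isotropic (V W : B -> Prop) e T : functional T ->
  (forall x, V x -> exists v t, W v /\ x = v + io t * e) ->
  (forall v w, W v -> W w -> T (v * w) = 0) -> hodge V T.
Proof.
move=> [TD TZ] VW T0 _ _ /VW[v [t [Wv ->]]] /VW[w [s [Ww ->]]].
have E v1 t1 v2 t2 : W v1 -> W v2 -> T ((v1 + io t1 * e) * (v2 + io t2 * e)) =
    t2 * T (v1 * e) + t1 * T (v2 * e) + t1 * (t2 * T (e * e)).
  move=> W1 W2; rewrite -[RHS]add0r -(T0 _ _ W1 W2) -!TZ -!TD.
  by congr T; ring.
rewrite !E // => _.
have := sqr_ge0 (t * T (w * e) - s * T (v * e)).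
by rewrite !expr2; lra.
Qed.

Lemma hodge_scale V T c : 0 <= c -> hodge V T -> hodge V (fun g => c * T g).
Proof.
move=> c0 hT x y Vx Vy; have [->|cn0] := eqVneq c 0; first by rewrite !mul0r ltxx.
have cp : 0 < c by rewrite lt_def cn0.
rewrite pmulr_rgt0 // => /(hT _ _ Vx Vy) H.
by rewrite mulrACA exprMn -expr2 ler_wpM2l // sqr_ge0.
Qed.

Lemma hodge_ext V T T' : (forall x y, V x -> V y -> T (x * y) = T' (x * y)) ->
  hodge V T -> hodge V T'.
Proof. by move=> e h x y Vx Vy; rewrite -!e //; apply: h. Qed.

Lemma hodge_sub (V V' : B -> Prop) T : (forall x, V' x -> V x) -> hodge V T -> hodge V' T.
Proof. by move=> s h x y Vx Vy; apply: h; apply: s. Qed.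

(** In the applications [D] is both a factor of [T] and the sum of the [xi j], and [Tj j] is, up to
    vanishing terms, [T] with the factor [D] replaced by [xi j]; [J] selects the pieces that
    survive. For [z = x - \sum_j s j * xi j], the Hodge inequalities of the [Tj j] at [D] and [z]
    bound [T (z * z)] by a sum of quotients whose denominators [Tj j (D * D)] are the row sums of
    [M], as [bochner_num] requires. *)
Lemma bochner V T D n (J : pred 'I_n) (Tj : 'I_n -> B -> R) (xi : 'I_n -> B) :
  functional T -> (forall j, functional (Tj j)) -> subspace V ->
  (forall j, V (xi j)) ->
  (forall x, V x -> T (x * D) = \sum_j T (x * xi j)) ->
  (forall x, V x -> T (x * x) = \sum_(j | J j) Tj j (x * x)) ->
  (forall x j, V x -> J j -> Tj j (x * D) = T (x * xi j)) ->
  (forall x j, V x -> ~~ J j -> T (x * xi j) = 0) ->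
  V D ->
  (forall j, J j -> hodge V (Tj j)) ->
  (forall j, J j -> 0 < Tj j (D * D)) ->
  (forall i j, J i -> J j -> i != j -> 0 < T (xi i * xi j)) ->
  forall x, V x -> T (x * D) = 0 -> T (x * x) <= 0.
Proof.
move=> fT fTj subV Vxi TD Txx TjD Tn VD hTj pD pM x Vx xD.
have Vc (s : 'I_n -> R) : V (x + \sum_j io (- s j) * xi j).
  elim: (index_enum _) => [|a r IH]; first by rewrite big_nil addr0.
  by rewrite big_cons addrCA addrC; apply: subV.
pose M : 'M[R]_n := \matrix_(i, j) T (xi i * xi j).
have symM i j : M i j = M j i by rewrite !mxE mulrC.
have M0 i j : ~~ J i -> M i j = 0 by move=> Ji; rewrite symM mxE Tn.
apply: (@bochner_num _ _ M J (fun j => T (x * xi j))) => //.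
- move=> i j ij; have [Ji|Ji] := boolP (J i); last by rewrite M0.
  have [Jj|Jj] := boolP (J j); last by rewrite symM M0.
  by rewrite mxE ltW // pM.
- by move=> i j Ji Jj ij; rewrite mxE pM.
- by move=> i; apply: Tn.
- by rewrite -TD.
move=> s; set z := x + \sum_j io (- s j) * xi j.
have Tz g : T (z * g) = T (x * g) - \sum_j s j * T (xi j * g).
  rewrite /z mulrDl fT.1 mulr_suml functional_sum // -sumrN; congr (_ + _).
  by apply: eq_bigr => j _; rewrite -mulrA fT.2 mulNr.
have Tzxi j : T (z * xi j) = T (x * xi j) - \sum_k M j k * s k.
  by rewrite Tz; congr (_ - _); apply: eq_bigr => k _; rewrite symM mxE mulrC.
have -> : T (x * x) - (\sum_j s j * T (x * xi j)) *+ 2 + \sum_i s i * (\sum_j M i j * s j)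
   = T (z * z).
  have -> : T (z * z) = T (x * x) - \sum_j s j * T (xi j * x) - \sum_j s j * T (xi j * z).
    by rewrite Tz [x * z]mulrC Tz.
  have -> : \sum_j s j * T (xi j * x) = \sum_j s j * T (x * xi j).
    by apply: eq_bigr => j _; rewrite [xi j * x]mulrC.
  have -> : \sum_j s j * T (xi j * z) =
      \sum_j s j * T (x * xi j) - \sum_i s i * (\sum_j M i j * s j).
    by rewrite -sumrB; apply: eq_bigr => j _; rewrite [xi j * z]mulrC Tzxi mulrBr.
  by rewrite mulr2n; ring.
have Vz : V z by apply: Vc.
rewrite (Txx z Vz) [leRHS](bigID J) /= [X in _ + X]big1 ?addr0; last first.
  move=> i Ji; rewrite Tn // big1 ?subrr ?expr0n ?mul0r //.
  by move=> k _; rewrite M0 // mul0r.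
apply: ler_sum => j Jj.
have pj : \sum_k M j k = Tj j (D * D).
  by rewrite TjD // [D * _]mulrC TD //; apply: eq_bigr => k _; rewrite mxE.
rewrite -Tzxi pj ler_pdivlMr ?pD // -TjD // mulrC [z * D]mulrC.
by apply: hTj => //; apply: pD.
Qed.
End HodgeForms.

(** * Divided differences *)

Section DividedDifferences.
Variable B : comNzRingType.
Implicit Types (G H : {poly B}) (y : nat -> B).

(** The divided difference (G(X) - G(c)) / (X - c); the divisor is monic, so no inverse in [B] is
    involved. *)
Definition dd (c : B) G : {poly B} := Pdiv.Ring.rdivp G ('X - c%:P).

Lemma dd_unique c G H a : G = H * ('X - c%:P) + a%:P -> dd c G = H.
Proof.
move=> ->; rewrite /dd Pdiv.RingMonic.rdivp_addl_mul_small ?monicXsubC //.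
by rewrite size_XsubC size_polyC; case: (a != 0).
Qed.

Lemma dd_spec c G : G = dd c G * ('X - c%:P) + G.[c]%:P.
Proof.
have : root (G - G.[c]%:P) c by rewrite rootE !hornerE subrr.
move=> /factor_theorem[q qE]; have GE : G = q * ('X - c%:P) + G.[c]%:P.
  by rewrite -qE subrK.
by rewrite (dd_unique GE).
Qed.

Lemma ddD c G H : dd c (G + H) = dd c G + dd c H.
Proof.
apply: (@dd_unique _ _ _ (G.[c] + H.[c])).
by rewrite {1}(dd_spec c G) {1}(dd_spec c H) rmorphD /=; ring.
Qed.

Lemma ddC c a G : dd c (a%:P * G) = a%:P * dd c G.
Proof.
apply: (@dd_unique _ _ _ (a * G.[c])).
by rewrite {1}(dd_spec c G) rmorphM /=; ring.
Qed.

Lemma size_dd c G : (size (dd c G) <= (size G).-1)%N.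
Proof.
have [->|dn0] := eqVneq (dd c G) 0; first by rewrite size_poly0.
have sM : size (dd c G * ('X - c%:P)) = (size (dd c G)).+1.
  by rewrite size_Mmonic ?monicXsubC // size_XsubC addn2.
have := dn0; rewrite -size_poly_gt0 => d_gt0.
rewrite [in X in (_ <= X)%N](dd_spec c G) size_polyDl sM //.
by rewrite size_polyC; case: (_ != 0).
Qed.

(** Both orders compute the division of [G] by (X - a)(X - b): same quotient, same linear
    coefficient of the remainder. *)
Lemma dd_comm a b G : dd a (dd b G) = dd b (dd a G) /\ (dd a G).[b] = (dd b G).[a].
Proof.
have E1 := dd_spec b G; have E2 := dd_spec a (dd b G).
set e := (dd b G).[a] in E2 *; set H := dd a (dd b G) in E2 *.
have E : dd a G = H * ('X - b%:P) + e%:P.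
  apply: (@dd_unique _ _ _ (e * (a - b) + G.[b])).
  by rewrite {1}E1 E2 rmorphD rmorphM rmorphB /=; ring.
by rewrite E (dd_unique erefl) !hornerE subrr mulr0 add0r.
Qed.

(* The divided difference of [G] at the nodes [y r, ..., y (r + k)]: it sends
   ['X^(k + j)] to the complete homogeneous polynomial [h_j] of the nodes. *)
Fixpoint pd y (k r : nat) G : B :=
  if k is k'.+1 then pd y k' r.+1 (dd (y r) G) else G.[y r].

Lemma pdD y k r G H : pd y k r (G + H) = pd y k r G + pd y k r H.
Proof. by elim: k r G H => [|k IH] r G H /=; rewrite ?hornerD // ddD IH. Qed.

Lemma pdC y k r a G : pd y k r (a%:P * G) = a * pd y k r G.
Proof. by elim: k r G => [|k IH] r G /=; rewrite ?hornerCM // ddC IH. Qed.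

Lemma pd_XsubC y k r G : pd y k.+1 r (('X - (y r)%:P) * G) = pd y k r.+1 G.
Proof. by rewrite /= (@dd_unique _ _ G 0) // addr0 mulrC. Qed.

Lemma pd0_XsubC y r G : pd y 0 r (('X - (y r)%:P) * G) = 0.
Proof. by rewrite /= !hornerE subrr mul0r. Qed.

Lemma pd_small y k r G : (size G <= k)%N -> pd y k r G = 0.
Proof.
elim: k r G => [|k IH] r G /= sG.
  by move/size_poly_leq0P: sG => ->; rewrite horner0.
by apply: IH; apply: leq_trans (size_dd _ _) _; rewrite -subn1 leq_subLR.
Qed.

Lemma pd_ext y z k r G : (forall i, (r <= i <= r + k)%N -> y i = z i) ->
  pd y k r G = pd z k r G.
Proof.
elim: k r G => [|k IH] r G /= e; first by rewrite e //; lia.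
by rewrite e; [apply: IH => i ?; apply: e; lia | lia].
Qed.

(** Symmetry in the nodes, for the adjacent exchanges that the model acts by. *)
Lemma pd_swap y i k r G : (r <= i < r + k)%N ->
  pd (fun j => if j == i then y i.+1 else if j == i.+1 then y i else y j) k r G = pd y k r G.
Proof.
elim: k r G => [|k IH] r G ri; first by lia.
have n1 : (r.+1 == r) = false by lia.
have [ir|ir] := eqVneq i r; last first.
  rewrite /= IH; last by lia.
  have E1 : (r == i) = false by rewrite eq_sym; apply/negbTE.
  have E2 : (r == i.+1) = false by lia.
  by rewrite E1 E2.
subst i; case: k {IH ri} => [|k] /=; rewrite !eqxx n1.
  by rewrite (dd_comm (y r) (y r.+1) G).2.
rewrite (dd_comm (y r) (y r.+1) G).1.
apply: pd_ext => i ri.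
have E1 : (i == r) = false by lia.
have E2 : (i == r.+1) = false by lia.
by rewrite E1 E2.
Qed.

Lemma pd_morph (f : {rmorphism B -> B}) y k r G :
  f (pd y k r G) = pd (f \o y) k r (map_poly f G).
Proof.
elim: k r G => [|k IH] r G /=; first by rewrite horner_map.
rewrite IH; congr pd; symmetry; apply: (@dd_unique _ _ _ (f G.[y r])).
rewrite {1}(dd_spec (y r) G) rmorphD rmorphM rmorphB /= map_polyX !map_polyC //.
Qed.

End DividedDifferences.

(** * Adjoining a variable to a model *)

Definition low (u : nat -> nat) r := fun i => if i == r then (u i).-1 else u i.
Definition swp (T : Type) (u : nat -> T) r :=
  fun i => if i == r then u r.+1 else if i == r.+1 then u r else u i.
Definition strict N (u : nat -> nat) := forall i, (i < N)%N -> (u i.+1 < u i)%N.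
(* Rows of [u] that cannot be lowered without destroying strictness. *)
Definition blocked N (u : nat -> nat) r :=
  if r == N then u r == 0%N else u r == (u r.+1).+1.
Definition tot N (u : nat -> nat) : nat := (\sum_(i < N.+1) u i)%N.
Definition staircase N := fun i => (N - i)%N.

Fixpoint alls (T : Type) (C : T -> Prop) s :=
  if s is d :: s' then C d /\ alls C s' else True.

Lemma tot_low N u r : (r <= N)%N -> (0 < u r)%N -> (tot N (low u r)).+1 = tot N u.
Proof.
move=> rN ur; have rN' : (r < N.+1)%N by [].
rewrite /tot (bigD1 (Ordinal rN')) //= [in RHS](bigD1 (Ordinal rN')) //= /low eqxx.
rewrite -addSn prednK //; congr addn; apply: eq_bigr => i.
by rewrite -val_eqE /= => /negPf->.
Qed.

Lemma strict_low N u r : strict N u -> (r <= N)%N -> ~~ blocked N u r ->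
  strict N (low u r) /\ (0 < u r)%N.
Proof.
move=> su rN; rewrite /blocked; have [->|rn] := eqVneq r N => nb.
  split; last by rewrite lt0n.
  move=> i iN; rewrite /low; have := su i iN.
  have -> : (i == N) = false by lia.
  by case: eqP => _; lia.
have rltN : (r < N)%N by lia.
have := su r rltN => sr; split; last by lia.
move=> i iN; rewrite /low; have := su i iN.
by case: (eqVneq i r) => [E|_]; case: (eqVneq i.+1 r) => [E'|_]; subst; lia.
Qed.

Lemma strict_ge N u : strict N u -> forall i, (i <= N)%N -> (N - i <= u i)%N.
Proof.
move=> su; have H j : (j <= N)%N -> (j <= u (N - j))%N.
  elim: j => [|j IH] jN //; have := IH (ltnW jN); have := su (N - j.+1)%N.
  by rewrite -subSn // subSS; lia.
by move=> i iN; have := H _ (leq_subr i N); rewrite subKn.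
Qed.

Lemma strict_tot N u : strict N u -> (tot N (staircase N) <= tot N u)%N.
Proof. by move=> su; apply: leq_sum => i _; apply: strict_ge; rewrite // -ltnS. Qed.

Section Model.
Variables (R : realFieldType) (N : nat).

(* [Phi u g] stands for the intersection number of [g] with the Schubert-type class
   indexed by [u], which is antisymmetric in the rows of [u]; [C] is the cone of
   positive classes in the space [V] of degree one classes, and [sh] shifts the degree. *)
Record hodge_model (B : comNzRingType) (io : {rmorphism R -> B}) (y : nat -> B)
    (Phi : (nat -> nat) -> B -> R) (tau : nat -> {rmorphism B -> B})
    (C V : B -> Prop) (sh : nat) : Prop := HodgeModel {
  mphi : forall u, functional io (Phi u);
  mext : forall u v g, (forall i, (i <= N)%N -> u i = v i) -> Phi u g = Phi v g;
  mlow : forall u i g, (i <= N)%N -> (0 < u i)%N -> Phi u (y i * g) = Phi (low u i) g;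
  mlow0 : forall u i g, (i <= N)%N -> u i = 0%N -> Phi u (y i * g) = 0;
  mswp : forall u i g, (i < N)%N -> Phi u (tau i g) = - Phi (swp u i) g;
  mtau_io : forall i c, (i < N)%N -> tau i (io c) = io c;
  mtau_y : forall i j, (i < N)%N -> (j <= N)%N -> tau i (y j) = swp y i j;
  mC_V : forall d, C d -> V d;
  mC_tau : forall d i, (i < N)%N -> C d -> tau i d = d;
  mV : subspace io V;
  mVy : forall i, (i <= N)%N -> V (y i);
  mVsym : forall v i, (i < N)%N -> V v ->
    exists z, tau i (v + io z * y i) = v + io z * y i;
  mpos : forall u Ds, strict N u -> alls C Ds ->
    (size Ds + tot N (staircase N) = tot N u + sh)%N -> 0 < Phi u (\prod_(d <- Ds) d);
  mhodge : forall u Ds, strict N u -> alls C Ds ->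
    ((size Ds).+2 + tot N (staircase N) = tot N u + sh)%N ->
    hodge V (fun g => Phi u ((\prod_(d <- Ds) d) * g)) }.

Variables (B : comNzRingType) (io : {rmorphism R -> B}) (y : nat -> B).
Variables (Phi : (nat -> nat) -> B -> R) (tau : nat -> {rmorphism B -> B}).
Variables (C V : B -> Prop) (sh : nat).
Hypothesis HM : hodge_model io y Phi tau C V sh.

Let io' : {rmorphism R -> {poly B}} := polyC \o io.
Let y' i : {poly B} := (y i)%:P.
Let tau' i : {rmorphism {poly B} -> {poly B}} := map_poly (tau i).
(** The coefficient of ['X] is strictly positive so that mixed products stay strictly positive;
    boundary classes such as ['X] itself are reached only in the limit. *)
Definition cone_step (G : {poly B}) := exists d (c : R), [/\ C d, 0 < c & G = d%:P + io' c * 'X].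
Definition space_step (G : {poly B}) := exists v (t : R), V v /\ G = v%:P + io' t * 'X.
Let C' := cone_step.
Let V' := space_step.
(* Pushforward of [G] along a projective bundle with roots [y (N - k), ..., y N]. *)
Definition Psi k u (G : {poly B}) := Phi u (pd y k (N - k) G).

Lemma Psi_functional k u : functional io' (Psi k u).
Proof.
have [D Z] := mphi HM u; split=> [a b|c g]; first by rewrite /Psi pdD D.
by rewrite /Psi /io' /= pdC Z.
Qed.

Lemma Psi_low k u i G : (i <= N)%N -> (0 < u i)%N -> Psi k u (y' i * G) = Psi k (low u i) G.
Proof. by move=> iN ui; rewrite /Psi /y' pdC (mlow HM). Qed.

Lemma Psi_low0 k u i G : (i <= N)%N -> u i = 0%N -> Psi k u (y' i * G) = 0.
Proof. by move=> iN ui; rewrite /Psi /y' pdC (mlow0 HM). Qed.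

Lemma Psi_sub k u G : (k < N)%N -> Psi k.+1 u (('X - y' (N - k.+1)) * G) = Psi k u G.
Proof.
by move=> kN; rewrite /Psi /y' pd_XsubC; congr (Phi _ (pd _ _ _ _)); lia.
Qed.

Lemma Psi_sub0 u G : Psi 0 u (('X - y' N) * G) = 0.
Proof. by rewrite /Psi subn0 /y' pd0_XsubC (functional0 (mphi HM u)). Qed.

Lemma Psi_small k u (G : {poly B}) : (size G <= k)%N -> Psi k u G = 0.
Proof. by move=> s; rewrite /Psi pd_small // (functional0 (mphi HM u)). Qed.

(** Both exchanged variables must be nodes, since the symmetry of the divided difference absorbs the
    action of [tau i] on them. *)
Lemma Psi_swp k u i G : (k <= N)%N -> (N - k <= i < N)%N ->
  Psi k u (tau' i G) = - Psi k (swp u i) G.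
Proof.
move=> kN /andP[ik iN]; rewrite /Psi -(mswp HM) // pd_morph.
rewrite -[in LHS](@pd_swap _ _ i) ?ik //=; last by lia.
congr (Phi u); apply: pd_ext => j jk /=.
rewrite (mtau_y HM) //; lia.
Qed.

Lemma Psi_eq0 k u i G : (k <= N)%N -> (N - k <= i < N)%N -> u i = u i.+1 ->
  tau' i G = G -> Psi k u G = 0.
Proof.
move=> kN ik ui tG; have := Psi_swp u G kN ik; rewrite tG.
have -> : Psi k (swp u i) G = Psi k u G.
  apply: (mext HM) => j _; rewrite /swp.
  by case: eqP => [->|_] //; case: eqP => [->|].
by move=> H; apply/eqP; rewrite -[_ == 0](@mulrn_eq0 R _ 2) mulr2n {1}H addNr.
Qed.

Lemma fixed_const D i : (i < N)%N -> alls C D ->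
  tau' i (\prod_(d <- D) d)%:P = (\prod_(d <- D) d)%:P.
Proof.
move=> iN; elim: D => [|d D IH] /=; first by rewrite big_nil rmorph1.
by case=> Cd /IH E; rewrite big_cons rmorphM rmorphM /= E /tau' /= map_polyC /= (mC_tau HM).
Qed.

Lemma fixed_cone G i : (i < N)%N -> C' G -> tau' i G = G.
Proof.
move=> iN [d [c [Cd _ ->]]]; rewrite rmorphD rmorphM /= /tau' /= map_polyX.
by rewrite !map_polyC /= (mC_tau HM) // (mtau_io HM).
Qed.

Lemma fixed_prod D i : (i < N)%N -> alls C' D ->
  tau' i (\prod_(d <- D) d) = \prod_(d <- D) d.
Proof.
move=> iN; elim: D => [|d D IH] /=; first by rewrite big_nil rmorph1.
by case=> Cd /IH E; rewrite big_cons rmorphM /= E fixed_cone.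
Qed.

Lemma size_prod_cone D : alls C' D -> (size (\prod_(d <- D) d : {poly B})%R <= (size D).+1)%N.
Proof.
elim: D => [|d D IH] /=; first by rewrite big_nil size_poly1.
case=> [[e [c [_ _ ->]]]] /IH s; rewrite big_cons.
apply: leq_trans (size_polyMleq _ _) _.
have : (size (e%:P + io' c * 'X : {poly B})%R <= 2)%N.
  rewrite (leq_trans (size_polyD _ _)) // geq_max (leq_trans (size_polyC_leq1 _)) //=.
  rewrite mul_polyC (leq_trans (size_scale_leq _ _)) //.
  by rewrite size_polyX.
by move=> s2; rewrite -subn1 leq_subLR (leq_trans (leq_add s2 s)) // add2n addn1.
Qed.

Lemma size_const_mul (a : B) (G : {poly B}) : (size (a%:P * G)%R <= size G)%N.
Proof. by rewrite mul_polyC size_scale_leq. Qed.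

Lemma Psi_mulD k u d c (G : {poly B}) :
  Psi k u ((d%:P + io' c * 'X) * G) = Psi k u (d%:P * G) + c * Psi k u ('X * G).
Proof.
have [D Z] := Psi_functional k u.
by rewrite mulrDl D -mulrA Z.
Qed.

(** The basic recursion: the first term drops a node, hence lowers [k], and the second lowers row
    [N - k] of [u]. *)
Lemma Psi_X k u (G : {poly B}) :
  Psi k u ('X * G) = Psi k u (('X - y' (N - k)%N) * G) + Psi k u (y' (N - k)%N * G).
Proof. by rewrite -(Psi_functional k u).1 -mulrDl subrK. Qed.

(** Lowering a blocked row either takes row [N] below zero or creates two equal adjacent rows; in
    the second case antisymmetry gives zero, for invariant [G]. *)
Lemma Psi_blocked k u (G : {poly B}) : (k <= N)%N -> strict N u -> blocked N u (N - k)%N ->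
  ((0 < k)%N -> tau' (N - k)%N G = G) -> Psi k u (y' (N - k)%N * G) = 0.
Proof.
move=> kN su; rewrite /blocked; case: k kN => [|k] kN.
  by rewrite subn0 eqxx => /eqP uN _; rewrite Psi_low0.
have -> : (N - k.+1 == N)%N = false by lia.
move=> /eqP ur tG; have rN : (N - k.+1 < N)%N by lia.
rewrite Psi_low; [|lia|by rewrite ur].
rewrite (@Psi_eq0 _ _ (N - k.+1)%N) //; first by lia.
  by rewrite /low eqxx ur; case: eqP => //; lia.
by apply: tG.
Qed.

(** Expanding the first factor [d + c X] of [D] by [Psi_X] gives three nonnegative terms. The
    strictly positive one drops a node if [k] is positive, and otherwise moves [d] into [D']; the
    recursion ends at [mpos]. If [k] exceeds the length of [D], the value is zero for degree
    reasons. *)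
Lemma step_pos D : forall k u D', strict N u -> (k <= N)%N -> alls C D' -> alls C' D ->
  (size D' + size D + tot N (staircase N) = tot N u + sh + k)%N ->
  0 <= Psi k u ((\prod_(d <- D') d)%:P * \prod_(d <- D) d) /\
  ((k <= size D)%N -> 0 < Psi k u ((\prod_(d <- D') d)%:P * \prod_(d <- D) d)).
Proof.
suff H : forall k u D', strict N u -> (k <= N)%N -> alls C D' -> alls C' D ->
  (size D' + size D + tot N (staircase N) = tot N u + sh + k)%N -> (k <= size D)%N ->
  0 < Psi k u ((\prod_(d <- D') d)%:P * \prod_(d <- D) d).
  move=> k u D' su kN CD' CD sE; split; last by apply: H.
  have [kD|Dk] := leqP k (size D); first by rewrite ltW // H.
  rewrite Psi_small //; apply: leq_trans (size_const_mul _ _) _.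
  exact: leq_trans (size_prod_cone CD) _.
have G_ge0 D1 k u D' : (forall k u D', strict N u -> (k <= N)%N -> alls C D' -> alls C' D1 ->
  (size D' + size D1 + tot N (staircase N) = tot N u + sh + k)%N -> (k <= size D1)%N ->
  0 < Psi k u ((\prod_(d <- D') d)%:P * \prod_(d <- D1) d)) -> strict N u -> (k <= N)%N ->
  alls C D' -> alls C' D1 ->
  (size D' + size D1 + tot N (staircase N) = tot N u + sh + k)%N ->
  0 <= Psi k u ((\prod_(d <- D') d)%:P * \prod_(d <- D1) d).
  move=> H su kN CD' CD sE.
  have [kD|Dk] := leqP k (size D1); first by rewrite ltW // H.
  rewrite Psi_small //; apply: leq_trans (size_const_mul _ _) _.
  exact: leq_trans (size_prod_cone CD) _.
elim: D => [|G D IH] k u D' su kN CD' CD sE kD.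
  move: kD; rewrite /= leqn0 => /eqP k0; subst k.
  rewrite big_nil mulr1 /Psi /= hornerC; apply: (mpos HM) => //.
  by move: sE; rewrite /=; lia.
case: CD => [[d [c [Cd c0 ->]]] CD] /=; rewrite big_cons mulrCA Psi_mulD.
rewrite /= in sE kD.
have dE : d%:P * ((\prod_(e <- D') e)%:P * \prod_(e <- D) e) =
   (\prod_(e <- d :: D') e)%:P * \prod_(e <- D) e.
  by rewrite big_cons rmorphM mulrA.
have d_ge0 : 0 <= Psi k u (d%:P * ((\prod_(e <- D') e)%:P * \prod_(e <- D) e)).
  by rewrite dE G_ge0 //=; lia.
have y_ge0 : 0 <= Psi k u (y' (N - k)%N * ((\prod_(e <- D') e)%:P * \prod_(e <- D) e)).
  have [b|nb] := boolP (blocked N u (N - k)%N).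
    rewrite Psi_blocked // => k0; have rN : (N - k < N)%N by lia.
    by rewrite rmorphM /= fixed_const // fixed_prod.
  have [sl ur] := strict_low su (leq_subr k N) nb.
  rewrite Psi_low ?leq_subr // G_ge0 //.
  by have := tot_low (leq_subr k N) ur; lia.
rewrite Psi_X; case: k => [|k] in kN sE kD d_ge0 y_ge0 *.
  rewrite subn0 Psi_sub0 add0r ltr_wpDr // ?dE ?IH //=; last by lia.
  by rewrite mulr_ge0 ?(ltW c0) //; move: y_ge0; rewrite subn0.
rewrite ltr_wpDl // mulr_gt0 // ltr_wpDr // Psi_sub // IH //; lia.
Qed.

Lemma space_const v : V v -> V' v%:P.
Proof. by move=> Vv; exists v, 0; rewrite rmorph0 mul0r addr0. Qed.

Lemma space_step_subspace : subspace io' V'.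
Proof.
move=> _ _ c [v [t [Vv ->]]] [w [s [Vw ->]]]; exists (v + io c * w), (t + c * s).
split; first exact: (mV HM).
by rewrite !rmorphD !rmorphM /=; ring.
Qed.

Lemma space0 : V 0.
Proof.
have Vy := mVy HM (leq0n N); have := mV HM (-1) Vy Vy.
by rewrite rmorphN rmorph1 mulN1r subrr.
Qed.

Lemma space_y i : (i <= N)%N -> V' (y' i).
Proof. by move=> iN; apply: space_const; apply: (mVy HM). Qed.

Lemma space_X c : V' (io' c * 'X).
Proof. by exists 0, c; split; [exact: space0 | rewrite add0r]. Qed.

Lemma cone_space G : C' G -> V' G.
Proof. by move=> [d [c [Cd _ ->]]]; exists d, c; split=> //; apply: (mC_V HM). Qed.

Lemma hodge_isotropic_X T : functional io' T ->
  (forall v w, V v -> V w -> T (v%:P * w%:P) = 0) -> hodge V' T.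
Proof.
move=> fT T0; apply: (@hodge_isotropic _ _ io' _ (fun G => exists2 v, V v & G = v%:P) 'X) => //.
  by move=> x [v [t [Vv ->]]]; exists v%:P, t; split=> //; exists v.
by move=> _ _ [v Vv ->] [w Vw ->]; apply: T0.
Qed.

(** For [k = 0] the divided difference is evaluation at [y N], which maps [V'] into [V]. *)
Lemma step_base u D' : strict N u -> alls C D' ->
  ((size D').+2 + tot N (staircase N) = tot N u + sh)%N ->
  hodge V' (fun g => Psi 0 u ((\prod_(d <- D') d)%:P * g)).
Proof.
move=> su CD' sE x z; have ev G : V' G -> V G.[y N].
  by move=> [v [t [Vv ->]]]; rewrite !hornerE; apply: (mV HM) => //; apply: (mVy HM).
move=> /ev Vx /ev Vz.
rewrite /Psi /= subn0 !hornerM !hornerC.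
exact: (mhodge HM su CD' sE).
Qed.

(** The induction is on the linear factors [D]; [k], [u] and the constants [D'] vary because the
    three pieces of a factor change exactly these. *)
Definition tail_hodge (D : seq {poly B}) := forall k u D', strict N u -> (k <= N)%N ->
  alls C D' -> ((size D' + size D).+2 + tot N (staircase N) = tot N u + sh + k)%N ->
  hodge V' (fun g => Psi k u ((\prod_(d <- D') d)%:P * \prod_(d <- D) d * g)).

Lemma step_free G D : C' G -> alls C' D -> tail_hodge D ->
  forall k u D', strict N u -> (k <= N)%N -> alls C D' -> (k <= (size D).+1)%N ->
  ((size D' + (size D).+1).+2 + tot N (staircase N) = tot N u + sh + k)%N ->
  (k == 0%N) || ~~ blocked N u (N - k)%N ->
  hodge V' (fun g => Psi k u ((\prod_(d <- D') d)%:P * (G * \prod_(d <- D) d) * g)).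
Proof.
move=> CG CD IH k u D' su kN CD' kD sE free.
have [d [c [Cd c0 GE]]] := CG.
set r := (N - k)%N in free *; have rN : (r <= N)%N by apply: leq_subr.
set p := (\prod_(e <- D') e)%:P; set q := \prod_(e <- D) e.
set T := fun g => Psi k u (p * (G * q) * g).
have fT : functional io' T by apply/functional_mul/Psi_functional.
pose xi (j : 'I_3) : {poly B} := if val j is 0%N then d%:P else
  if val j is 1%N then (io c)%:P * ('X - y' r) else (io c)%:P * y' r.
pose Tj (j : 'I_3) (g : {poly B}) : R := if val j is 0%N then Psi k u (d%:P * p * q * g) else
  if val j is 1%N then c * Psi k.-1 u (p * q * g) else c * Psi k (low u r) (p * q * g).
pose J (j : 'I_3) := if val j is 0%N then true else
  if val j is 1%N then (0 < k)%N else ~~ blocked N u r.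
have TZ e g : Psi k u ((io e)%:P * g) = e * Psi k u g by apply: (Psi_functional k u).2.
have Pxi j g : Psi k u (xi j * (p * q * g)) = if J j then Tj j g else 0.
  case: j => [[|[|[|//]]] ji]; rewrite /xi /J /Tj /=.
  - by rewrite !mulrA.
  - rewrite -mulrA TZ /r; case: (k) (kN) => [|k'] k'N /=; first by rewrite subn0 Psi_sub0 mulr0.
    by rewrite Psi_sub.
  - rewrite -mulrA TZ; have [nb|b] := boolP (~~ blocked N u r).
      by have [_ ur] := strict_low su rN nb; rewrite Psi_low.
    move: b free; rewrite negbK => b; rewrite b orbF => /eqP k0.
    move: b; rewrite /blocked /r k0 subn0 eqxx => /eqP uN.
    by rewrite Psi_low0 // mulr0.
have Txi j x : T (x * xi j) = if J j then Tj j (x * G) else 0.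
  by rewrite -Pxi /T; congr (Psi k u); ring.
have dD' : (\prod_(e <- d :: D') e)%:P = d%:P * p by rewrite big_cons rmorphM.
have CG' : alls C' (G :: D) by [].
have CGG : alls C' (G :: G :: D) by [].
have Cd' : alls C (d :: D') by [].
have sl : ~~ blocked N u r -> strict N (low u r) /\ (tot N (low u r)).+1 = tot N u.
  by move=> nb; have [? ?] := strict_low su rN nb; rewrite tot_low.
have GE3 : G = \sum_j xi j by rewrite !big_ord_recl big_ord0 /xi /= GE; ring.
have Vxi j : V' (xi j).
  case: j => [[|[|[|//]]] ji]; rewrite /xi /=.
  - exact/space_const/(mC_V HM).
  - have -> : (io c)%:P * ('X - y' r) = (io c)%:P * 'X + (io (- c))%:P * y' r by rewrite !rmorphN; ring.
    by apply: space_step_subspace; [exact: space_X | exact: space_y].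
  - rewrite -[_ * _]add0r; apply: space_step_subspace; last exact: space_y.
    by rewrite -(mul0r 'X) -(rmorph0 io'); apply: space_X.
apply: (@hodge_orth _ _ io' _ _ G fT space_step_subspace).
apply: (@bochner _ _ io' V' T G _ J Tj xi) => //.
- move=> [[|[|[|//]]] ji]; rewrite /Tj /=.
  + exact/functional_mul/Psi_functional.
  + exact/functional_scale/functional_mul/Psi_functional.
  + exact/functional_scale/functional_mul/Psi_functional.
- exact: space_step_subspace.
- by move=> x _; rewrite {1}GE3 mulr_sumr (functional_sum fT).
- move=> x _; have -> : T (x * x) = \sum_j Psi k u (xi j * (p * q * (x * x))).
    rewrite -(functional_sum (Psi_functional k u)) -mulr_suml -GE3.
    by rewrite /T; congr (Psi k u); ring.
  by rewrite [RHS]big_mkcond; apply: eq_bigr => j _; rewrite Pxi.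
- by move=> x j _ Jj; rewrite Txi Jj.
- by move=> x j _ /negPf Jj; rewrite Txi Jj.
- exact: cone_space.
- move=> [[|[|[|//]]] ji]; rewrite /Tj /J /=.
  + move=> _; rewrite -dD'; apply: IH => //=; lia.
  + by move=> k0; apply: hodge_scale; [exact: ltW | apply: IH => //; lia].
  + by move=> /sl[? ?]; apply: hodge_scale; [exact: ltW | apply: IH => //; lia].
- move=> [[|[|[|//]]] ji]; rewrite /Tj /J /=.
  + move=> _; have -> : d%:P * p * q * (G * G) =
      (\prod_(e <- d :: D') e)%:P * \prod_(e <- G :: G :: D) e.
      by rewrite dD' !big_cons -/q; ring.
    by apply: (step_pos su kN Cd' CGG _).2 => /=; lia.
  + move=> k0; rewrite mulr_gt0 //; have -> : p * q * (G * G) =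
      (\prod_(e <- D') e)%:P * \prod_(e <- G :: G :: D) e.
      by rewrite !big_cons -/p -/q; ring.
    by apply: (step_pos su _ CD' CGG _).2 => /=; lia.
  + move=> /sl[? ?]; rewrite mulr_gt0 //; have -> : p * q * (G * G) =
      (\prod_(e <- D') e)%:P * \prod_(e <- G :: G :: D) e.
      by rewrite !big_cons -/p -/q; ring.
    by apply: (step_pos _ kN CD' CGG _).2 => //=; lia.
have pdG : (\prod_(e <- d :: D') e)%:P * \prod_(e <- G :: D) e = p * q * (d%:P * G).
  by rewrite dD' big_cons -/q; ring.
have j1 : (1 < 3)%N by []. have j2 : (2 < 3)%N by [].
(* Off-diagonal entries of the weight matrix. In [M02] the bound on [k] is sharp: [k] is unchanged
   and only the factors [G :: D] remain. *)
have M01 : (0 < k)%N -> 0 < T (d%:P * xi (Ordinal j1)).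
  move=> k0; rewrite Txi /J /Tj /= k0 mulr_gt0 // -pdG.
  by apply: (step_pos su _ Cd' CG' _).2 => /=; lia.
have M02 : ~~ blocked N u r -> 0 < T (d%:P * xi (Ordinal j2)).
  move=> nb; rewrite Txi /J /Tj /= nb mulr_gt0 // -pdG.
  move: (sl nb) => [? ?].
  by apply: (step_pos _ kN Cd' CG' _).2 => //=; lia.
have M21 : (0 < k)%N -> ~~ blocked N u r -> 0 < T ((io c)%:P * y' r * xi (Ordinal j1)).
  move=> k0 nb; rewrite Txi /J /Tj /= k0 mulr_gt0 //.
  have [? ur] := strict_low su rN nb; move: (sl nb) => [_ ?].
  have -> : p * q * ((io c)%:P * y' r * G) = (io c)%:P * (y' r * (p * q * G)) by ring.
  rewrite (Psi_functional _ _).2 mulr_gt0 // Psi_low //.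
  have -> : p * q * G = (\prod_(e <- D') e)%:P * \prod_(e <- G :: D) e.
    by rewrite big_cons -/p -/q; ring.
  by apply: (step_pos _ _ CD' CG' _).2 => //=; lia.
have symT x z : T (x * z) = T (z * x) by rewrite mulrC.
move=> [[|[|[|//]]] ji] [[|[|[|//]]] jj] //; rewrite {1 2}/J /= => Ji Jj _.
- by rewrite /xi /= in M01 *; exact: M01.
- by rewrite /xi /= in M02 *; exact: M02.
- by rewrite symT; rewrite /xi /= in M01 *; exact: M01.
- by rewrite symT; rewrite /xi /= in M21 *; exact: M21.
- by rewrite symT; rewrite /xi /= in M02 *; exact: M02.
- by rewrite /xi /= in M21 *; exact: M21.
Qed.

(** On classes fixed by [tau' r], multiplication by ['X] merely lowers [k], so [bochner] applies
    there with the two pieces [d] and [c X]. Any [x] becomes fixed after adding a multiple of [y_r];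
    the cross terms vanish and the square of [y_r] is nonpositive. *)
Lemma step_blocked G D : C' G -> alls C' D -> tail_hodge D ->
  forall k u D', strict N u -> (0 < k <= N)%N -> alls C D' -> (k <= (size D).+1)%N ->
  ((size D' + (size D).+1).+2 + tot N (staircase N) = tot N u + sh + k)%N ->
  blocked N u (N - k)%N ->
  hodge V' (fun g => Psi k u ((\prod_(d <- D') d)%:P * (G * \prod_(d <- D) d) * g)).
Proof.
move=> CG CD IH k u D' su /andP[k0 kN] CD' kD sE bl.
have [d [c [Cd c0 GE]]] := CG.
set r := (N - k)%N in bl; have rN : (r < N)%N by rewrite /r; lia.
have ur : u r = (u r.+1).+1.
  by apply/eqP; move: bl; rewrite /blocked ifN_eq // neq_ltn rN.
set p := (\prod_(e <- D') e)%:P; set q := \prod_(e <- D) e.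
set T := fun g => Psi k u (p * (G * q) * g).
have fT : functional io' T by apply/functional_mul/Psi_functional.
have TZ e g : Psi k u ((io e)%:P * g) = e * Psi k u g by apply: (Psi_functional k u).2.
have fixp : tau' r p = p by apply: fixed_const.
have fixG : tau' r G = G by apply: fixed_cone.
have fixq : tau' r q = q by apply: fixed_prod.
have bl0 g : tau' r g = g -> Psi k u (y' r * g) = 0 by move=> ?; apply: Psi_blocked.
have PsiX g : tau' r g = g -> Psi k u ('X * g) = Psi k.-1 u g.
  move=> fg; rewrite Psi_X -/r bl0 // addr0 /r -{1 2}(prednK k0) Psi_sub //.
  by rewrite prednK.
pose W x := V' x /\ tau' r x = x.
have subW : subspace io' W.
  move=> x z e [Vx fx] [Vz fz]; split; first exact: space_step_subspace.
  by rewrite rmorphD rmorphM fx fz /= /tau' /= map_polyC /= (mtau_io HM).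
have fixX : tau' r 'X = 'X by rewrite /tau' /= map_polyX.
have Tneg x : W x -> T (x * G) = 0 -> T (x * x) <= 0.
  pose xi (j : 'I_2) : {poly B} := if val j is 0%N then d%:P else (io c)%:P * 'X.
  pose Tj (j : 'I_2) (g : {poly B}) : R := if val j is 0%N then Psi k u (d%:P * p * q * g)
    else c * Psi k.-1 u (p * q * g).
  have dD' : (\prod_(e <- d :: D') e)%:P = d%:P * p by rewrite big_cons rmorphM.
  have CGG : alls C' (G :: G :: D) by [].
  have CG' : alls C' (G :: D) by [].
  have Cd' : alls C (d :: D') by [].
  have fixd : tau' r d%:P = d%:P by rewrite /tau' /= map_polyC /= (mC_tau HM).
  have Pxi j g : tau' r g = g -> Psi k u (xi j * (p * q * g)) = Tj j g.
    move=> fg; case: j => [[|[|//]] ji]; rewrite /xi /Tj /=; first by rewrite !mulrA.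
    by rewrite -mulrA TZ PsiX // !rmorphM fixp fixq fg.
  have Txi j g : W g -> T (g * xi j) = Tj j (g * G).
    move=> [_ fg]; rewrite -Pxi; last by rewrite rmorphM fg fixG.
    by rewrite /T; congr (Psi k u); ring.
  have GE2 : G = \sum_j xi j by rewrite !big_ord_recl big_ord0 /xi /= GE addr0.
  have Wd : W d%:P by split=> //; exact/space_const/(mC_V HM).
  have Wxi j : W (xi j).
    case: j => [[|[|//]] ji]; rewrite /xi //=.
    split; first exact: space_X.
    by rewrite rmorphM /= fixX /tau' /= map_polyC /= (mtau_io HM).
  have j1 : (1 < 2)%N by [].
  have M01 : 0 < T (d%:P * xi (Ordinal j1)).
    rewrite Txi // /Tj /= mulr_gt0 //.
    have -> : p * q * (d%:P * G) = (\prod_(e <- d :: D') e)%:P * \prod_(e <- G :: D) e.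
      by rewrite dD' big_cons -/q; ring.
    by apply: (step_pos su _ Cd' CG' _).2 => /=; lia.
  apply: (@bochner _ _ io' W T G _ predT Tj xi) => //.
  - move=> [[|[|//]] ji]; rewrite /Tj /=.
    + exact/functional_mul/Psi_functional.
    + exact/functional_scale/functional_mul/Psi_functional.
  - by move=> z _; rewrite {1}GE2 mulr_sumr (functional_sum fT).
  - move=> z [_ fz]; have -> : T (z * z) = \sum_j Psi k u (xi j * (p * q * (z * z))).
      rewrite -(functional_sum (Psi_functional k u)) -mulr_suml -GE2.
      by rewrite /T; congr (Psi k u); ring.
    by apply: eq_bigr => j _; rewrite Pxi // rmorphM fz.
  - by move=> z j Wz _; rewrite Txi.
  - by split=> //; apply: cone_space.
  - move=> [[|[|//]] ji] _; rewrite /Tj /=; apply: (@hodge_sub _ _ V') => [z [] //|].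
    + rewrite -dD'; apply: IH => //=; lia.
    + by apply: hodge_scale; [exact: ltW | apply: IH => //; lia].
  - move=> [[|[|//]] ji] _; rewrite /Tj /=.
    + have -> : d%:P * p * q * (G * G) =
        (\prod_(e <- d :: D') e)%:P * \prod_(e <- G :: G :: D) e.
        by rewrite dD' !big_cons -/q; ring.
      by apply: (step_pos su kN Cd' CGG _).2 => /=; lia.
    + rewrite mulr_gt0 //; have -> : p * q * (G * G) =
        (\prod_(e <- D') e)%:P * \prod_(e <- G :: G :: D) e.
        by rewrite !big_cons -/p -/q; ring.
      by apply: (step_pos su _ CD' CGG _).2 => /=; lia.
  - move=> [[|[|//]] ji] [[|[|//]] jj] // _ _ _.
    + have symT a b : T (a * b) = T (b * a) by rewrite mulrC.
      by rewrite symT.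
have fixH : tau' r (p * (G * q)) = p * (G * q) by rewrite !rmorphM fixp fixG fixq.
have Ty g : tau' r g = g -> T (g * y' r) = 0.
  move=> fg; have -> : T (g * y' r) = Psi k u (y' r * (p * (G * q) * g)).
    by rewrite /T; congr (Psi k u); ring.
  by rewrite bl0 // rmorphM fixH fg.
(* Two lowerings take row [r] to [u r.+1 - 1]; exchanging it with row [r.+1] restores the order at
   the cost of a sign, and gives [u] with both rows lowered once. This is strict unless row [r.+1]
   is blocked too, in which case the value is zero. *)
have Tyy : T (y' r * y' r) <= 0.
  have -> : T (y' r * y' r) = Psi k u (y' r * (y' r * (p * (G * q)))).
    by rewrite /T; congr (Psi k u); ring.
  rewrite Psi_low ?ur //; last exact: ltnW.
  have lr : low u r r = u r.+1 by rewrite /low eqxx ur.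
  have [u0|un0] := eqVneq (u r.+1) 0%N; first by rewrite Psi_low0 ?lr // ltnW.
  rewrite Psi_low ?lr ?lt0n //; last exact: ltnW.
  rewrite -fixH Psi_swp //; last by move: rN; rewrite /r; lia.
  rewrite oppr_le0; set w := low (low u r.+1) r.
  have wE i : swp (low (low u r) r) r i = w i.
    have n1 : (r.+1 == r) = false by lia.
    have n2 : (r == r.+1) = false by lia.
    rewrite /swp /w /low; case: (eqVneq i r) => [->|ir].
      by rewrite ?eqxx ?n1 ?n2 ?ur.
    by case: (eqVneq i r.+1) => [->|]; rewrite ?eqxx ?n1 ?n2 ?ur // (negPf ir).
  have -> : Psi k (swp (low (low u r) r) r) (p * (G * q)) = Psi k w (p * (G * q)).
    by apply: (mext HM) => i _; apply: wE.
  have r1r : (r == r.+1) = false by lia.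
  have [b|nb] := boolP (blocked N u r.+1).
    have r1 : (r.+1 < N)%N.
      by move: b; rewrite /blocked; case: (eqVneq r.+1 N) => [E|]; [lia | move: rN; lia].
    have u1 : u r.+1 = (u r.+2).+1.
      by apply/eqP; move: b; rewrite /blocked ifN_eq // neq_ltn r1.
    rewrite (@Psi_eq0 _ _ r.+1) //; first by rewrite /r; lia.
      have m1 : (r.+1 == r) = false by lia.
      have m2 : (r.+2 == r) = false by lia.
      have m3 : (r.+2 == r.+1) = false by lia.
      by rewrite /w /low eqxx m1 m2 m3 u1.
    by rewrite !rmorphM /= fixed_const // fixed_cone // fixed_prod.
  have [sl1 u1] := strict_low su rN nb.
  have nb2 : ~~ blocked N (low u r.+1) r.
    by rewrite /blocked ifN_eq ?neq_ltn ?rN // /low eqxx r1r ur; lia.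
  have [sl2 u2] := strict_low sl1 (ltnW rN) nb2.
  have := tot_low rN u1; have := tot_low (ltnW rN) u2.
  have -> : G * q = \prod_(e <- G :: D) e by rewrite big_cons.
  move=> ? ?; apply: (step_pos sl2 kN CD' _ _).1 => //=.
  by move: sE; rewrite /w; lia.
apply: (@hodge_orth _ _ io' _ _ G fT space_step_subspace) => x Vx xG.
have [z fx] : exists z, tau' r (x + (io z)%:P * y' r) = x + (io z)%:P * y' r.
  have [v [t [Vv ->]]] := Vx; have [z fz] := mVsym HM rN Vv; exists z.
  have -> : v%:P + io' t * 'X + (io z)%:P * y' r = (v + io z * y r)%:P + (io t)%:P * 'X.
    by rewrite rmorphD rmorphM /= /y' /io' /=; ring.
  rewrite rmorphD rmorphM fixX; congr (_ + _ * _); rewrite /tau' /= map_polyC /= ?fz //.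
  by rewrite (mtau_io HM).
set x' := x + (io z)%:P * y' r in fx.
have Vx' : V' x' by apply: space_step_subspace => //; apply: space_y; apply: ltnW.
have [TD TZ'] := fT.
have TS e g : T ((io e)%:P * g) = e * T g by apply: TZ'.
have x'G : T (x' * G) = 0.
  by rewrite /x' mulrDl TD xG -mulrA TS [y' r * G]mulrC Ty // mulr0 addr0.
have := Tneg x' (conj Vx' fx) x'G.
have -> : x * x = x' * x' + (io (- z))%:P * (x' * y' r) + (io (- z))%:P * (x' * y' r)
    + (io (z * z))%:P * (y' r * y' r).
  by rewrite /x' !rmorphN !rmorphM /=; ring.
rewrite !TD !TS Ty // !mulr0 !addr0 => H.
have : z * z * T (y' r * y' r) <= 0 by rewrite mulr_ge0_le0 // -expr2 sqr_ge0.
by move: H; lra.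
Qed.

(** If [k] exceeds the number of linear factors, products of two constants vanish for degree
    reasons, so [V'] is an isotropic space plus the line of ['X]. Otherwise the first factor is
    split off. *)
Lemma step_hodge D : alls C' D -> tail_hodge D.
Proof.
elim: D => [|G D IH] CD k u D' su kN CD' sE.
  case: k => [|k] in kN sE *.
    rewrite big_nil mulr1; apply: step_base => //; move: sE; rewrite /=; lia.
  apply: hodge_isotropic_X => [|v w Vv Vw]; first exact/functional_mul/Psi_functional.
  rewrite big_nil mulr1 -!rmorphM Psi_small // size_polyC.
  by case: (_ != 0).
have [k_small|k_big] := ltnP (size (G :: D)) k.
  apply: hodge_isotropic_X => [|v w Vv Vw]; first exact/functional_mul/Psi_functional.
  rewrite Psi_small //; set q := \prod_(d <- G :: D) d.
  have -> : (\prod_(d <- D') d)%:P * q * (v%:P * w%:P) = (\prod_(d <- D') d * v * w)%:P * q.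
    by rewrite !rmorphM /=; ring.
  apply: leq_trans (size_const_mul _ _) (leq_trans (size_prod_cone CD) k_small).
have [CG CD1] := CD; rewrite big_cons.
rewrite /= in sE k_big.
have [free|] := boolP ((k == 0%N) || ~~ blocked N u (N - k)%N).
  by apply: step_free => //; apply: IH.
rewrite negb_or negbK -lt0n => /andP[k0 b].
by apply: step_blocked => //; [exact: IH | rewrite k0].
Qed.

(** Only [Psi N], with all variables as nodes, is antisymmetric in all rows; smaller [k] served the
    induction. *)
Lemma step_model : hodge_model io' y' (Psi N) tau' C' V' (sh + N).
Proof.
split.
- exact: Psi_functional.
- by move=> u v g uv; apply: (mext HM).
- by move=> u i g iN ui; apply: Psi_low.
- by move=> u i g iN ui; apply: Psi_low0.
- by move=> u i g iN; apply: Psi_swp; rewrite // subnn.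
- by move=> i c iN; rewrite /tau' /= map_polyC /= (mtau_io HM).
- move=> i j iN jN; rewrite /tau' /= map_polyC /= (mtau_y HM) // /swp /y'.
  by case: ifP => // _; case: ifP.
- exact: cone_space.
- by move=> d i iN; apply: fixed_cone.
- exact: space_step_subspace.
- exact: space_y.
- move=> x i iN [v [t [Vv ->]]]; have [z fz] := mVsym HM iN Vv; exists z.
  have -> : v%:P + io' t * 'X + io' z * y' i = (v + io z * y i)%:P + (io t)%:P * 'X.
    by rewrite rmorphD rmorphM /= /y' /io' /=; ring.
  rewrite rmorphD rmorphM /= /tau' /= map_polyX; congr (_ + _ * _).
    by rewrite map_polyC /= fz.
  by rewrite map_polyC /= (mtau_io HM).
- move=> u D su CD sE; have := strict_tot su => ?.
  have sE' : (size (Nil B) + size D + tot N (staircase N) = tot N u + sh + N)%N.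
    by rewrite add0n sE addnA.
  have := (@step_pos D N u [::] su (leqnn N) I CD sE').2.
  by rewrite big_nil mul1r; apply; move: sE => /=; lia.
- move=> u D su CD sE; have := step_hodge CD su (leqnn N) (I : alls C [::]).
  rewrite big_nil mul1r; by apply; rewrite /= add0n sE addnA.
Qed.

End Model.

(** * The initial model *)

Section Base.
Variables (R : realFieldType) (N : nat).
Variables (B : comNzRingType) (io : {rmorphism R -> B}) (y : nat -> B).
Variables (Phi : (nat -> nat) -> B -> R) (tau : nat -> {rmorphism B -> B}).

Hypothesis phiF : forall u, functional io (Phi u).
Hypothesis phi_ext : forall u v g, (forall i, (i <= N)%N -> u i = v i) -> Phi u g = Phi v g.
Hypothesis phi_low : forall u i g, (i <= N)%N -> (0 < u i)%N ->
  Phi u (y i * g) = Phi (low u i) g.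
Hypothesis phi_low0 : forall u i g, (i <= N)%N -> u i = 0%N -> Phi u (y i * g) = 0.
Hypothesis phi_swp : forall u i g, (i < N)%N -> Phi u (tau i g) = - Phi (swp u i) g.
Hypothesis tau_io : forall i c, (i < N)%N -> tau i (io c) = io c.
Hypothesis tau_y : forall i j, (i < N)%N -> (j <= N)%N -> tau i (y j) = swp y i j.
Hypothesis phi_one : Phi (staircase N) 1 = 1.
Hypothesis phi_big : forall u, (N < u 0)%N -> Phi u 1 = 0.

Definition lincomb (s : nat -> R) : B := \sum_(i < N.+1) io (s i) * y i.
Definition linforms (x : B) := exists s, x = lincomb s.
Definition sigma : B := \sum_(i < N.+1) y i.
Definition sigma_cone (d : B) := exists2 c : R, 0 < c & d = io c * sigma.

Lemma sigmaE : sigma = lincomb (fun=> 1).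
Proof. by apply: eq_bigr => i _; rewrite rmorph1 mul1r. Qed.

Lemma lincomb_subspace : subspace io linforms.
Proof.
move=> _ _ c [s ->] [t ->]; exists (fun i => s i + c * t i).
rewrite /lincomb mulr_sumr -big_split; apply: eq_bigr => i _.
by rewrite rmorphD rmorphM mulrDl mulrA.
Qed.

Lemma lincomb_y i : (i <= N)%N -> linforms (y i).
Proof.
move=> iN; exists (fun j => (j == i)%:R); have iN' : (i < N.+1)%N by [].
rewrite /lincomb (bigD1 (Ordinal iN')) //= eqxx rmorph1 mul1r big1 ?addr0 // => j.
by rewrite -val_eqE /= => /negPf->; rewrite rmorph0 mul0r.
Qed.

Lemma tau_lincomb i s : (i < N)%N -> s i = s i.+1 -> tau i (lincomb s) = lincomb s.
Proof.
move=> iN si; have i1 : (i < N.+1)%N by lia. have i2 : (i.+1 < N.+1)%N by lia.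
rewrite /lincomb rmorph_sum.
have ne : Ordinal i2 != Ordinal i1 by rewrite -val_eqE /=; lia.
rewrite (bigD1 (Ordinal i1)) //= (bigD1 (Ordinal i2)) //=.
rewrite [RHS](bigD1 (Ordinal i1)) //= [in RHS](bigD1 (Ordinal i2)) //=.
have n1 : (i.+1 == i) = false by lia.
rewrite !rmorphM /= !tau_io ?tau_y //; try lia.
rewrite /swp !eqxx n1 !addrA si [_ * y i.+1 + _]addrC; congr (_ + _).
apply: eq_bigr => j /andP[j1 j2]; rewrite rmorphM /= tau_io ?tau_y //; last by rewrite -ltnS.
by move: j1 j2; rewrite -!val_eqE /= /swp => /negPf-> /negPf->.
Qed.

Lemma tau_sigma i : (i < N)%N -> tau i sigma = sigma.
Proof. by move=> iN; rewrite sigmaE tau_lincomb. Qed.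

Lemma phi_eq0 u i g : (i < N)%N -> u i = u i.+1 -> tau i g = g -> Phi u g = 0.
Proof.
move=> iN ui tg; have := phi_swp u g iN; rewrite tg.
have -> : Phi (swp u i) g = Phi u g.
  apply: phi_ext => j _; rewrite /swp.
  by case: eqP => [->|_] //; case: eqP => [->|].
by move=> H; apply/eqP; rewrite -[_ == 0](@mulrn_eq0 R _ 2) mulr2n {1}H addNr.
Qed.

Lemma blockedE u i : (i < N)%N -> blocked N u i -> u i = (u i.+1).+1.
Proof. by move=> iN; rewrite /blocked ifN_eq ?neq_ltn ?iN // => /eqP. Qed.

Lemma phi_blocked u i g : (i <= N)%N -> blocked N u i ->
  ((i < N)%N -> tau i g = g) -> Phi u (y i * g) = 0.
Proof.
move=> iN b tg; have [E|ltiN] := eqVneq i N.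
  by move: b; rewrite /blocked E eqxx => /eqP u0; rewrite phi_low0.
have iN' : (i < N)%N by lia.
have ui := blockedE iN' b; rewrite phi_low ?ui //.
apply: (phi_eq0 iN'); last exact: tg.
by rewrite /low eqxx ui; have -> : (i.+1 == i) = false by lia.
Qed.

Lemma tau_sigmaX i q : (i < N)%N -> tau i (sigma ^+ q) = sigma ^+ q.
Proof. by move=> iN; rewrite rmorphXn /= tau_sigma. Qed.

Lemma phi_sigmaS u q g : Phi u (sigma ^+ q.+1 * g) = \sum_(i < N.+1) Phi u (y i * (sigma ^+ q * g)).
Proof.
rewrite -(functional_sum (phiF u)) -mulr_suml exprS -/sigma; congr (Phi u); ring.
Qed.

Lemma strict_eq_staircase u : strict N u -> tot N u = tot N (staircase N) ->
  forall i, (i <= N)%N -> u i = staircase N i.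
Proof.
move=> su tE i iN; apply/eqP; rewrite eqn_leq strict_ge // andbT.
have iN' : (i < N.+1)%N by [].
move: tE; rewrite /tot (bigD1 (Ordinal iN')) //= [in RHS](bigD1 (Ordinal iN')) //=.
have : (\sum_(j < N.+1 | j != Ordinal iN') staircase N j <=
        \sum_(j < N.+1 | j != Ordinal iN') u j)%N.
  by apply: leq_sum => j _; apply: strict_ge; rewrite // -ltnS.
move=> le tE; rewrite -(leq_add2r (\sum_(j < N.+1 | j != Ordinal iN') u j)) tE.
by rewrite leq_add2l.
Qed.

(** If every row is blocked, reading upwards from row [N] shows that [u] is the staircase. *)
Lemma exists_free u : strict N u -> (tot N (staircase N) < tot N u)%N ->
  exists2 i, (i <= N)%N & ~~ blocked N u i.
Proof.
move=> su lt; have [b|] := boolP [forall i : 'I_N.+1, blocked N u i]; last first.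
  by rewrite negb_forall => /existsP[i bi]; exists i => //; rewrite -ltnS.
move: lt; rewrite ltnNge => /negP[]; apply: leq_sum => i _.
have {}b j : (j <= N)%N -> blocked N u j.
  by move=> jN; have jN' : (j < N.+1)%N by []; have /forallP/(_ (Ordinal jN')) := b.
have H j : (j <= N)%N -> u (N - j)%N = j.
  elim: j => [|j IH] jN; first by have := b N (leqnn N); rewrite /blocked eqxx subn0 => /eqP.
  have jN' : (N - j.+1 < N)%N by lia.
  have := blockedE jN' (b _ (ltnW jN')).
  by rewrite -subSn // subSS => ->; rewrite IH // ltnW.
have iN : (i <= N)%N by rewrite -ltnS.
by have := H (N - i)%N (leq_subr _ _); rewrite subKn // /staircase => ->.
Qed.

(** Each factor [sigma] removes one box in all possible ways, so the value counts standard Young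
    tableaux. *)
Lemma sigma_pos q : forall u, strict N u ->
  (q + tot N (staircase N) = tot N u)%N -> 0 < Phi u (sigma ^+ q).
Proof.
elim: q => [|q IH] u su tE.
  have -> : Phi u (sigma ^+ 0) = Phi (staircase N) 1.
    rewrite expr0; apply: phi_ext => i iN.
    by apply: (@strict_eq_staircase u).
  by rewrite phi_one.
have pos i : (i <= N)%N -> ~~ blocked N u i -> 0 < Phi u (y i * sigma ^+ q).
  move=> iN nb; have [sl ui] := strict_low su iN nb; rewrite phi_low // IH //.
  by have := tot_low iN ui; lia.
have [i iN nb] : exists2 i, (i <= N)%N & ~~ blocked N u i by apply: exists_free => //; lia.
rewrite -[sigma ^+ _]mulr1 phi_sigmaS; have iN' : (i < N.+1)%N by [].
under eq_bigr => j _ do rewrite mulr1.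
rewrite (bigD1 (Ordinal iN')) //= ltr_wpDr ?pos //.
apply: sumr_ge0 => j _; have jN : (j <= N)%N by rewrite -ltnS.
have [b|nbj] := boolP (blocked N u j); last by rewrite ltW // pos.
by rewrite phi_blocked // => ?; apply: tau_sigmaX.
Qed.

(** The double lowering and exchange used for [Tyy] in [step_blocked]. *)
Lemma phi_diag u r q : strict N u -> (r <= N)%N -> blocked N u r ->
  (q.+2 + tot N (staircase N) = tot N u)%N -> Phi u (y r * (y r * sigma ^+ q)) <= 0.
Proof.
move=> su rN b tE; have [E|ltrN] := eqVneq r N.
  by move: b; rewrite /blocked E eqxx => /eqP u0; rewrite phi_low0.
have {ltrN} rN' : (r < N)%N by lia.
have ur := blockedE rN' b.
have lr : low u r r = u r.+1 by rewrite /low eqxx ur.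
rewrite phi_low ?ur //; have [u0|un0] := eqVneq (u r.+1) 0%N; first by rewrite phi_low0 ?lr.
rewrite phi_low ?lr ?lt0n // -(tau_sigmaX q rN') phi_swp // oppr_le0.
set w := low (low u r.+1) r.
have n1 : (r.+1 == r) = false by lia.
have n2 : (r == r.+1) = false by lia.
have wE i : swp (low (low u r) r) r i = w i.
  rewrite /swp /w /low; case: (eqVneq i r) => [->|ir]; first by rewrite ?eqxx ?n1 ?n2 ?ur.
  by case: (eqVneq i r.+1) => [->|]; rewrite ?eqxx ?n1 ?n2 ?ur // (negPf ir).
rewrite (@phi_ext _ w) //.
have [b1|nb] := boolP (blocked N u r.+1).
  have [E|ltrN] := eqVneq r.+1 N.
    by move: b1 un0; rewrite /blocked E eqxx => ->.
  have {ltrN} r1N : (r.+1 < N)%N by lia.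
  rewrite (@phi_eq0 _ r.+1) ?tau_sigmaX //.
  have m2 : (r.+2 == r) = false by lia.
  have m3 : (r.+2 == r.+1) = false by lia.
  by rewrite /w /low eqxx n1 m2 m3 (blockedE r1N b1).
have [sl1 u1] := strict_low su rN' nb.
have nb2 : ~~ blocked N (low u r.+1) r.
  by rewrite /blocked ifN_eq ?neq_ltn ?rN' // /low eqxx n2 ur; lia.
have [sl2 u2] := strict_low sl1 rN nb2.
rewrite ltW // sigma_pos //.
by have := tot_low rN' u1; have := tot_low rN u2; rewrite -/w; lia.
Qed.

Fixpoint rp (u : nat -> nat) j : nat :=
  if j is j'.+1 then if blocked N u (N - j)%N then rp u j' else (N - j)%N else N.
(* The rows [i, ..., rep u i] form a maximal run of consecutive values of [u]. *)
Definition rep u i := rp u (N - i)%N.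

Lemma rep_free u i : (i <= N)%N -> ~~ blocked N u i -> rep u i = i.
Proof.
move=> iN nb; rewrite /rep; have := subKn iN.
by case: (N - i)%N => [|j] /=; rewrite ?subn0 // => ->; rewrite (negPf nb).
Qed.

Lemma rep_blocked u i : (i < N)%N -> blocked N u i -> rep u i = rep u i.+1.
Proof.
move=> iN b; rewrite /rep.
have -> : (N - i = (N - i.+1).+1)%N by lia.
rewrite /=; have -> : (N - (N - i.+1).+1 = i)%N by lia.
by rewrite b.
Qed.

Definition sym_coef u (s : nat -> R) :=
  forall i, (i < N)%N -> blocked N u i -> s i = s i.+1.
Definition sym_forms u (x : B) := exists2 s, sym_coef u s & x = lincomb s.

Lemma sym_rep u (s : nat -> R) : sym_coef u (s \o rep u).
Proof. by move=> i iN b; rewrite /= rep_blocked. Qed.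

Lemma sym_forms_subspace u : subspace io (sym_forms u).
Proof.
move=> _ _ c [s ss ->] [t st ->]; exists (fun i => s i + c * t i).
  by move=> i iN b; rewrite ss // st.
rewrite /lincomb mulr_sumr -big_split; apply: eq_bigr => i _.
by rewrite rmorphD rmorphM mulrDl mulrA.
Qed.

(** [bochner] is applied to the forms fixed by the exchanges at all blocked rows, with one piece per
    free row [j]: [xi j] is the sum over the run ending at [j], of which only [y j] contributes. A
    general form differs from such a form by a combination of blocked [y i], which are orthogonal to
    the fixed forms and to each other, and have nonpositive squares. *)
Lemma base_hodge q : forall u, strict N u ->
  (q.+2 + tot N (staircase N) = tot N u)%N ->
  hodge linforms (fun g => Phi u (sigma ^+ q * g)).
Proof.
elim: q => [|q IH] u su tE.
  (* In degree two [u 0] exceeds [N], and lowering other rows does not change this; by [phi_big] the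
     forms without [y 0] are therefore isotropic. *)
  apply: (@hodge_isotropic _ _ io _
    (fun x => exists s, x = \sum_(i < N.+1 | i != ord0) io (s i) * y i) (y 0%N)).
  - exact/functional_mul/phiF.
  - move=> x [s ->]; exists (\sum_(i < N.+1 | i != ord0) io (s i) * y i), (s 0%N).
    by split; [exists s | rewrite /lincomb (bigD1 ord0) //= addrC].
  have u0 : (N < u 0)%N.
    rewrite ltnNge; apply/negP => u0.
    have: (tot N u <= tot N (staircase N))%N.
      apply: leq_sum => i _; rewrite /staircase.
      have H j : (j <= N)%N -> (u j <= N - j)%N.
        elim: j => [|j IHj] jN; first by rewrite subn0.
        by have := su j jN; have := IHj (ltnW jN); lia.
      by apply: H; rewrite -ltnS.
    by lia.
  have P0 v i : (i <= N)%N -> i != 0%N -> (N < v 0)%N -> Phi v (y i) = 0.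
    move=> iN i0 v0; rewrite -[y i]mulr1.
    have [vi|] := posnP (v i); first by rewrite phi_low0.
    by move=> vi; rewrite phi_low // phi_big // /low eq_sym (negPf i0).
  move=> _ _ [s ->] [t ->]; rewrite expr0 mul1r mulr_suml (functional_sum (phiF u)).
  rewrite big1 // => i i0; rewrite -mulrA (phiF u).2 mulr_sumr (functional_sum (phiF u)).
  rewrite big1 ?mulr0 // => j j0; rewrite mulrCA (phiF u).2.
  have iN : (i <= N)%N by rewrite -ltnS.
  have jN : (j <= N)%N by rewrite -ltnS.
  have [ui|] := posnP (u i); first by rewrite phi_low0 // mulr0.
  move=> ui; rewrite phi_low // P0 ?mulr0 //.
  by rewrite /low eq_sym -[(_ == _)%N]/(i == ord0) (negPf i0).
set T := fun g => Phi u (sigma ^+ q.+1 * g).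
have fT : functional io T by apply/functional_mul/phiF.
pose free (j : 'I_N.+1) := ~~ blocked N u j.
have leN (j : 'I_N.+1) : (j <= N)%N by rewrite -ltnS.
have fixsym i x : (i < N)%N -> blocked N u i -> sym_forms u x -> tau i x = x.
  by move=> iN b [s ss ->]; apply: tau_lincomb => //; apply: ss.
have Tb (j : 'I_N.+1) x : ~~ free j -> sym_forms u x -> T (x * y j) = 0.
  rewrite negbK => b Sx; have -> : T (x * y j) = Phi u (y j * (sigma ^+ q.+1 * x)).
    by rewrite /T; congr (Phi u); ring.
  rewrite phi_blocked // => jN; rewrite rmorphM /= tau_sigmaX // fixsym //.
have Tbb (j t : 'I_N.+1) : ~~ free t -> val j != val t -> val j != (val t).+1 -> T (y j * y t) = 0.
  rewrite negbK => b jt jt1; have -> : T (y j * y t) = Phi u (y t * (sigma ^+ q.+1 * y j)).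
    by rewrite /T; congr (Phi u); ring.
  rewrite phi_blocked // => tN; rewrite rmorphM /= tau_sigmaX // tau_y //.
  by rewrite /swp (negPf jt) (negPf jt1).
have Tlin x s : sym_forms u x -> T (x * lincomb s) = \sum_(j | free j) s j * T (x * y j).
  move=> Sx; rewrite mulr_sumr (functional_sum fT) (bigID free) /= [X in _ + X]big1 ?addr0.
    by apply: eq_bigr => j _; rewrite mulrCA fT.2.
  by move=> j bj; rewrite mulrCA fT.2 Tb // mulr0.
pose xi (j : 'I_N.+1) := lincomb (fun i => (rep u i == j)%:R).
have Sxi j : sym_forms u (xi j).
  exists (fun i => (rep u i == j)%:R) => // i iN b.
  by rewrite (rep_blocked iN b).
have Txi x j : sym_forms u x -> T (x * xi j) = if free j then T (x * y j) else 0.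
  move=> Sx; rewrite Tlin // (eq_bigr (fun i : 'I_N.+1 => (i == j)%:R * T (x * y i))); last first.
    by move=> i fi; rewrite rep_free // -val_eqE.
  case: ifP => fj.
    rewrite (bigD1 j) //= eqxx mul1r big1 ?addr0 // => i /andP[_ /negPf->]; exact: mul0r.
  rewrite big1 // => i fi; case: eqP => [E|]; last by rewrite mul0r.
  by rewrite -E fi in fj.
have Ssig : sym_forms u sigma by rewrite sigmaE; exists (fun=> 1).
pose Tj (j : 'I_N.+1) g := Phi (low u j) (sigma ^+ q * g).
have sl j : free j -> [/\ strict N (low u j), (0 < u j)%N & (tot N (low u j)).+1 = tot N u].
  by move=> fj; have [? ?] := strict_low su (leN j) fj; split=> //; apply: tot_low.
have symneg x : sym_forms u x -> T (x * sigma) = 0 -> T (x * x) <= 0.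
  apply: (@bochner _ _ io (sym_forms u) T sigma _ free Tj xi) => //.
  - by move=> j; apply/functional_mul/phiF.
  - exact: sym_forms_subspace.
  - move=> z Sz; rewrite sigmaE Tlin // big_mkcond; apply: eq_bigr => j _.
    by rewrite mul1r Txi.
  - move=> z Sz; rewrite /T phi_sigmaS (bigID free) /= [X in _ + X]big1 ?addr0.
      by apply: eq_bigr => j fj; have [_ uj _] := sl j fj; rewrite phi_low.
    move=> j; rewrite negbK => bj; rewrite phi_blocked // => jN.
    by rewrite !rmorphM /= tau_sigmaX // !fixsym.
  - move=> z j Sz fj; have [_ uj _] := sl j fj; rewrite Txi // fj /Tj -phi_low //.
    by rewrite /T exprS; congr (Phi u); ring.
  - by move=> z j Sz /negPf fj; rewrite Txi // fj.
  - move=> j fj; have [sj uj tj] := sl j fj.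
    apply: (@hodge_sub _ _ linforms) => [z [s _ ->]|]; first by exists s.
    by apply: IH => //; lia.
  - move=> j fj; have [sj uj tj] := sl j fj; rewrite /Tj -expr2 -exprD.
    by apply: sigma_pos => //; lia.
  - move=> i j fi fj ij; rewrite Txi // fj mulrC.
    have -> : T (y j * xi i) = T (y j * y i).
      rewrite /xi /lincomb mulr_sumr (functional_sum fT) (bigD1 i) //= rep_free // eqxx.
      rewrite rmorph1 mul1r big1 ?addr0 // => t ti; rewrite mulrCA fT.2.
      have [rt|] := eqVneq (rep u t) i; last by rewrite mul0r.
      rewrite mul1r; have [ft|bt] := boolP (free t).
        by move: rt; rewrite rep_free // => /val_inj E; rewrite E eqxx in ti.
      apply: Tbb => //.
        by apply/eqP => /val_inj E; rewrite -E fj in bt.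
      apply/eqP => E; have jt : (j = t.+1 :> nat) by [].
      have tN : (t < N)%N by have := leN j; rewrite jt.
      move: bt; rewrite negbK => bt; move: rt; rewrite rep_blocked // -jt rep_free //.
      by move/val_inj => E'; rewrite E' eqxx in ij.
    have [sj uj tj] := sl j fj.
    have -> : T (y j * y i) = Phi u (y j * (y i * sigma ^+ q.+1)).
      by rewrite /T; congr (Phi u); ring.
    rewrite phi_low //.
    have nb : ~~ blocked N (low u j) i.
      have ijn : (i == j :> nat) = false by apply/negbTE.
      move: fi; rewrite /free /blocked /low ijn.
      have sui := su i; have iN := leN i.
      case: (eqVneq (i : nat) N) => // iN' fi'.
      have iltN : (i < N)%N by rewrite ltn_neqAle iN'.
      have := sui iltN; case: (eqVneq i.+1 (j : nat)) => [E|] lt; last by [].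
      by move: fi' lt; rewrite E prednK // => fi' lt; rewrite gtn_eqF.
    have [sij uij] := strict_low sj (leN i) nb.
    rewrite phi_low // sigma_pos //.
    by have := tot_low (leN i) uij; lia.
apply: (@hodge_orth _ _ io _ _ sigma fT lincomb_subspace) => _ [s ->] xs0.
set xs := lincomb (s \o rep u); have Sxs : sym_forms u xs.
  by exists (s \o rep u) => //; apply: sym_rep.
pose z i := s i - s (rep u i).
have xE : lincomb s = xs + lincomb z.
  rewrite /xs /lincomb -big_split /=; apply: eq_bigr => i _.
  by rewrite -mulrDl -rmorphD /z addrC subrK.
have zfree j : free j -> z j = 0 by move=> fj; rewrite /z rep_free // subrr.
have Tz x : sym_forms u x -> T (x * lincomb z) = 0.
  by move=> Sx; rewrite Tlin // big1 // => j fj; rewrite zfree // mul0r.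
have TD := fT.1.
have : T (xs * sigma) = 0.
  by rewrite -xs0 xE mulrDl TD [lincomb z * _]mulrC Tz // addr0.
move=> /(symneg _ Sxs) H.
have -> : lincomb s * lincomb s = xs * xs + xs * lincomb z + xs * lincomb z + lincomb z * lincomb z.
  by rewrite xE; ring.
rewrite !TD !(Tz xs Sxs) !addr0.
suff : T (lincomb z * lincomb z) <= 0 by move: H; lra.
rewrite {1}/lincomb mulr_suml (functional_sum fT); apply: sumr_le0 => i _.
rewrite -mulrA fT.2; have [fi|bi] := boolP (free i); first by rewrite zfree // mul0r.
have -> : T (y i * lincomb z) = z i * T (y i * y i).
  rewrite /lincomb mulr_sumr (functional_sum fT) (bigD1 i) //= big1 ?addr0; last first.
    move=> t ti; rewrite mulrCA fT.2.
    have [ft|bt] := boolP (free t); first by rewrite zfree // mul0r.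
    have it : val i != val t by rewrite eq_sym.
    (* [Tbb] is not symmetric: for adjacent blocked rows only one order of the factors is
       allowed. *)
    have [E|n1] := eqVneq (val i) (val t).+1; last by rewrite Tbb // mulr0.
    by rewrite mulrC [y i * y t]mulrC Tbb ?mul0r // eq_sym //; rewrite ?E; lia.
  by rewrite mulrCA fT.2.
rewrite mulrA mulr_ge0_le0 // -?expr2 ?sqr_ge0 //.
have -> : T (y i * y i) = Phi u (y i * (y i * sigma ^+ q.+1)).
  by rewrite /T; congr (Phi u); ring.
by apply: phi_diag => //; move: bi; rewrite negbK.
Qed.

Lemma base_model : hodge_model N io y Phi tau sigma_cone linforms 0.
Proof.
have prodE Ds : alls sigma_cone Ds ->
    exists2 c : R, 0 < c & \prod_(d <- Ds) d = io c * sigma ^+ size Ds.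
  elim: Ds => [|d Ds IH] /=; first by exists 1; rewrite // big_nil rmorph1 mul1r.
  case=> [[c c0 ->]] /IH[c' c'0 E]; exists (c * c'); first exact: mulr_gt0.
  by rewrite big_cons E exprS rmorphM; ring.
split=> //.
- move=> d [c _ ->]; exists (fun=> c); rewrite sigmaE /lincomb mulr_sumr.
  by apply: eq_bigr => i _; rewrite rmorph1 mul1r.
- by move=> d i iN [c _ ->]; rewrite rmorphM /= tau_io // tau_sigma.
- exact: lincomb_subspace.
- exact: lincomb_y.
- move=> v i iN [s ->]; exists (s i.+1 - s i).
  have -> : lincomb s + io (s i.+1 - s i) * y i =
      lincomb (fun j => if j == i then s i.+1 else s j).
    have iN' : (i < N.+1)%N by lia.
    rewrite /lincomb (bigD1 (Ordinal iN')) //= [in RHS](bigD1 (Ordinal iN')) //= eqxx.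
    rewrite addrAC -mulrDl -rmorphD [s i + _]addrC subrK; congr (_ + _).
    by apply: eq_bigr => j; rewrite -val_eqE /= => /negPf->.
  by apply: tau_lincomb => //; rewrite eqxx; case: ifP => // /eqP; lia.
- move=> u Ds su /prodE[c c0 ->] tE; rewrite (phiF u).2 mulr_gt0 // sigma_pos //.
  by rewrite tE addn0.
- move=> u Ds su /prodE[c c0 E] tE; apply: (@hodge_ext _ _ _ (fun g => c * Phi u (sigma ^+ size Ds * g))).
    by move=> a b _ _; rewrite E -mulrA (phiF u).2.
  by apply: hodge_scale; [exact: ltW | apply: base_hodge => //; rewrite tE addn0].
Qed.

End Base.

(** * Coefficients against the Vandermonde polynomial *)

Section MpolyModel.
Variables (R : realFieldType) (N : nat).
Notation B := {mpoly R[N.+1]}.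

Local Notation "m # s" := [multinom m (s i) | i < N.+1]
  (at level 40, left associativity, format "m # s").

Definition mnmf (u : nat -> nat) : 'X_{1..N.+1} := [multinom u i | i < N.+1].
(** In the Leibniz expansion antisymmetry is a reindexing and the coefficients can be read off. *)
Definition vdm : B := \sum_(s : 'S_N.+1) (-1) ^+ s *: 'X_[mnmf (staircase N)#s].
Definition mphi0 (u : nat -> nat) (g : B) : R := (vdm * g)@_(mnmf u).
Definition mvar (i : nat) : B := 'X_(inord i).
Definition mio : {rmorphism R -> B} := @mpolyC N.+1 R.
Definition mtau (i : nat) : {rmorphism B -> B} := msym (tperm (inord i : 'I_N.+1) (inord i.+1)).

Lemma vdm_anti (s : 'S_N.+1) : msym s vdm = (-1) ^+ s *: vdm.
Proof.
rewrite /vdm raddf_sum scaler_sumr /= (reindex_inj (mulgI s)) /=.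
apply: eq_bigr => t _; rewrite msymZ msymX odd_permM signr_addb scalerA; congr (_ *: 'X_[_]).
by apply/mnmP => i; rewrite !mnmE permM permKV.
Qed.

Lemma mcoeff_vdm m : vdm@_m = \sum_(s : 'S_N.+1) (-1) ^+ s * (mnmf (staircase N)#s == m)%:R.
Proof.
by rewrite /vdm raddf_sum /=; apply: eq_bigr => s _; rewrite mcoeffZ mcoeffX.
Qed.

Lemma mphi0_functional u : functional mio (mphi0 u).
Proof.
split=> [a b|c g]; rewrite /mphi0; first by rewrite mulrDr mcoeffD.
by rewrite mulrCA mcoeffCM.
Qed.

Lemma mphi0_ext u v g : (forall i, (i <= N)%N -> u i = v i) -> mphi0 u g = mphi0 v g.
Proof.
by move=> uv; rewrite /mphi0; congr (_@__); apply/mnmP => i; rewrite !mnmE uv // -ltnS.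
Qed.

Lemma mnmf_low u i : (i <= N)%N -> (0 < u i)%N ->
  mnmf u = (mnmf (low u i) + U_(inord i))%MM.
Proof.
move=> iN ui; apply/mnmP => j; rewrite !mnmE /low.
rewrite -val_eqE /= inordK // [(i == j)%N]eq_sym.
by case: eqP => [->|_]; rewrite ?addn1 ?prednK ?addn0.
Qed.

Lemma mphi0_low u i g : (i <= N)%N -> (0 < u i)%N -> mphi0 u (mvar i * g) = mphi0 (low u i) g.
Proof.
move=> iN ui; rewrite /mphi0 (mnmf_low iN ui) mulrCA mulrC.
by rewrite /mvar addmC mcoeffMX.
Qed.

Lemma mphi0_low0 u i g : (i <= N)%N -> u i = 0%N -> mphi0 u (mvar i * g) = 0.
Proof.
move=> iN ui; rewrite /mphi0 mulrCA mulrC; apply/eqP; rewrite mcoeff_eq0.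
rewrite /mvar (perm_mem (msuppMX _ _)); apply/mapP => -[m _] /mnmP/(_ (inord i)).
by rewrite !mnmE eqxx inordK // ui.
Qed.

Lemma mnmf_swp u i : (i < N)%N ->
  mnmf (swp u i) = mnmf u # (tperm (inord i : 'I_N.+1) (inord i.+1)).
Proof.
move=> iN; apply/mnmP => j; rewrite !mnmE /swp; case: tpermP => [->|->|].
- by rewrite !inordK ?eqxx //; lia.
- rewrite !inordK ?eqxx; try lia.
  by have -> : (i.+1 == i) = false by lia.
- move=> /eqP n1 /eqP n2; move: n1 n2; rewrite -!val_eqE /= !inordK; try lia.
  by move=> /negPf-> /negPf->.
Qed.

Lemma mphi0_swp u i g : (i < N)%N -> mphi0 u (mtau i g) = - mphi0 (swp u i) g.
Proof.
move=> iN; rewrite /mphi0 mnmf_swp // -mcoeff_sym rmorphM /= vdm_anti.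
have -> : odd_perm (tperm (inord i : 'I_N.+1) (inord i.+1)).
  by rewrite odd_tperm -val_eqE /= !inordK; lia.
by rewrite expr1 scaleN1r mulNr mcoeffN opprK.
Qed.

Lemma mtau_const i c : (i < N)%N -> mtau i (mio c) = mio c.
Proof.
by move=> _; rewrite /mtau /mio /= -[c%:MP]mulr1 mul_mpolyC msymZ msym1.
Qed.

Lemma mtau_var i j : (i < N)%N -> (j <= N)%N -> mtau i (mvar j) = swp mvar i j.
Proof.
move=> iN jN; rewrite /mtau /mvar /= msymX /swp.
have -> : U_(inord j)%MM # (tperm (inord i) (inord i.+1))^-1%g =
   U_(tperm (inord i : 'I_N.+1) (inord i.+1) (inord j))%MM.
  apply/mnmP => k; rewrite !mnmE tpermV; congr nat_of_bool.
  by rewrite -(inj_eq (@perm_inj _ (tperm (inord i) (inord i.+1)))) tpermK.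
case: tpermP.
- by move/(congr1 val); rewrite /= !inordK; try lia; move=> ->; rewrite eqxx.
- move/(congr1 val); rewrite /= !inordK; try lia; move=> ->; rewrite eqxx.
  by have -> : (i.+1 == i) = false by lia.
- move=> /eqP n1 /eqP n2; move: n1 n2; rewrite -!val_eqE /= !inordK; try lia.
  by move=> /negPf-> /negPf->.
Qed.

Lemma mphi0_one : mphi0 (staircase N) 1 = 1.
Proof.
rewrite /mphi0 mulr1 mcoeff_vdm (bigD1 1%g) //= big1 ?addr0.
  rewrite odd_perm1 expr0 mul1r; case: eqP => // -[]; apply/mnmP => i.
  by rewrite !mnmE perm1.
move=> s s1; case: eqP => [/mnmP E|]; last by rewrite mulr0.
case/eqP: s1; apply/permP => i; rewrite perm1; apply: val_inj.
have := E i; rewrite !mnmE /staircase.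
by have := ltn_ord i; have := ltn_ord (s i); rewrite /=; lia.
Qed.

Lemma mphi0_big u : (N < u 0)%N -> mphi0 u 1 = 0.
Proof.
move=> u0; rewrite /mphi0 mulr1 mcoeff_vdm big1 // => s _.
case: eqP => [/mnmP/(_ ord0)|]; last by rewrite mulr0.
by rewrite !mnmE /staircase /= => E; move: u0; rewrite -E; lia.
Qed.

Lemma mpoly_model :
  hodge_model N mio mvar mphi0 mtau (sigma_cone N mio mvar) (linforms N mio mvar) 0.
Proof.
apply: base_model.
- exact: mphi0_functional.
- exact: mphi0_ext.
- exact: mphi0_low.
- exact: mphi0_low0.
- exact: mphi0_swp.
- exact: mtau_const.
- exact: mtau_var.
- exact: mphi0_one.
- exact: mphi0_big.
Qed.

End MpolyModel.

(** * Kostka numbers *)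

Definition ext N b (v : {ffun 'I_N.+1 -> 'I_b}) : nat -> nat := fun i => v (inord i).

(* [u = lambda + (N, ..., 1, 0)], so [u i.+1 < v i <= u i] says that [u / v] is a
   horizontal strip; rows above [r] are frozen. *)
Definition pstrip N b r (u : nat -> nat) (v : {ffun 'I_N.+1 -> 'I_b}) c : bool :=
  [forall i : 'I_N.+1, if (i < r)%N then v i == u i :> nat else
     (v i <= u i)%N && ((i < N)%N ==> (u i.+1 < v i)%N)]
  && (tot N (ext v) + c == tot N u)%N.

(** The Kostka number as a count of chains of horizontal strips of sizes [mu 0], [mu 1], ... growing
    from the empty partition. The bound on the values of [v] only makes the sum finite. *)
Fixpoint kt N n (u mu : nat -> nat) : nat :=
  if n is n'.+1 then
    (\sum_(v : {ffun 'I_N.+1 -> 'I_(u 0%N).+1} | pstrip 0 u v (mu n')) kt N n' (ext v) mu)%N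
  else [forall i : 'I_N.+1, u i == (N - i)%N].

Lemma tot_ext N b (v : {ffun 'I_N.+1 -> 'I_b}) : tot N (ext v) = (\sum_(i < N.+1) v i)%N.
Proof. by apply: eq_bigr => i _; rewrite /ext inord_val. Qed.

Lemma strict_strip N b u (v : {ffun 'I_N.+1 -> 'I_b}) c : strict N u ->
  pstrip 0 u v c -> strict N (ext v).
Proof.
move=> su /andP[/forallP H _] i iN; rewrite /ext.
have := H (inord i); have := H (inord i.+1); rewrite !inordK ?ltnS //=; last exact: ltnW.
move=> /andP[h1 _] /andP[_ /implyP/(_ iN) h2]; exact: leq_ltn_trans h1 h2.
Qed.

Section Strips.
Variables (R : realFieldType) (N : nat).
Variables (B : comNzRingType) (io : {rmorphism R -> B}) (y : nat -> B).
Variables (Phi : (nat -> nat) -> B -> R) (tau : nat -> {rmorphism B -> B}).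
Variables (C V : B -> Prop) (sh : nat).
Hypothesis HM : hodge_model N io y Phi tau C V sh.
Variables (b : nat) (g : B).
Hypothesis fixg : forall i, (i < N)%N -> tau i g = g.

Definition strip_sum r u c : R :=
  \sum_(v : {ffun 'I_N.+1 -> 'I_b} | pstrip r u v c) Phi (ext v) g.

(** Either row [r] keeps its length and becomes frozen, or it loses a box. With the rows above [r]
    frozen, lowering [u r] cannot relax the constraint on row [r - 1]. *)
Lemma strip_sum_split r u c : (r <= N)%N -> strict N u ->
  strip_sum r u c = strip_sum r.+1 u c +
    (if c is c'.+1 then if blocked N u r then 0 else strip_sum r (low u r) c' else 0).
Proof.
move=> rN su; rewrite /strip_sum (bigID (fun v : {ffun 'I_N.+1 -> 'I_b} => v (inord r) == u r :> nat)) /=.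
have rE (i : 'I_N.+1) : (i == r :> nat) -> i = inord r.
  by move=> /eqP ir; apply: val_inj; rewrite /= inordK.
congr (_ + _).
  apply: eq_bigl => v; rewrite /pstrip andbAC; congr (_ && _).
  apply/andP/forallP => [[/forallP H /eqP vr] i|H].
    rewrite ltnS; move: (H i); case: (ltngtP (i : nat) r) => // /eqP ir _.
    by rewrite (rE i ir) inordK // vr eqxx.
  have vr : v (inord r) = u r :> nat by have := H (inord r); rewrite inordK // ltnSn => /eqP.
  split; last by rewrite vr.
  apply/forallP => i; move: (H i); rewrite ltnS; case: (ltngtP (i : nat) r) => // /eqP ir _.
  by rewrite (rE i ir) inordK // vr leqnn /=; apply/implyP => rN'; exact: su.
have le_all v : [forall i : 'I_N.+1, if (i < r)%N then v i == u i :> nat else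
     (v i <= u i)%N && ((i < N)%N ==> (u i.+1 < v i)%N)] ->
     forall i : 'I_N.+1, (v i <= u i)%N.
  by move=> /forallP H i; have := H i; case: ifP => _; [move=> /eqP-> | case/andP].
case: c => [|c].
  rewrite big1 // => v /andP[/andP[/le_all le /eqP]]; rewrite addn0 tot_ext => tE vr.
  have {}vr : (v (inord r) < u r)%N.
    by rewrite ltn_neqAle vr; have := le (inord r); rewrite inordK.
  suff : (\sum_(i < N.+1) v i < tot N u)%N by rewrite tE ltnn.
  rewrite /tot (bigD1 (inord r)) //= [X in (_ < X)%N](bigD1 (inord r)) //= -addSn.
  by apply: leq_add; [rewrite inordK | apply: leq_sum].
case: ifP => [bl|/negbT nb].
  rewrite big1 // => v /andP[/andP[/forallP/(_ (inord r)) ]]; rewrite inordK // ltnn.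
  move=> /andP[le /implyP lt] _ /eqP ne; exfalso; move: bl; rewrite /blocked.
  case: eqP => [E /eqP u0|/eqP n /eqP uE]; first by apply: ne; lia.
  have rN' : (r < N)%N by lia.
  by apply: ne; have := lt rN'; lia.
have [sl ur] := strict_low su rN nb.
apply: eq_bigl => v; rewrite /pstrip -(tot_low rN ur) addnS eqSS andbAC; congr (_ && _).
apply/andP/forallP => [[/forallP H vr] i|H].
  have := H i; rewrite /low; case: (eqVneq (i : nat) r) => [ir|ir].
    move: vr; rewrite -(rE i) ?ir // ltnn => vr /andP[le lt].
    have -> : (r.+1 == r) = false by lia.
    by rewrite -ltnS prednK // ltn_neqAle vr le.
  case: ifP => // ri; have -> : (i.+1 == r) = false by lia.
  by [].
have Hr := H (inord r); move: Hr; rewrite inordK // ltnn /low eqxx => /andP[vr _].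
split; last by apply/eqP; lia.
apply/forallP => i; have := H i; rewrite /low; case: (eqVneq (i : nat) r) => [ir|ir].
  rewrite ir ltnn; have -> : (r.+1 == r) = false by lia.
  by move=> /andP[le ->]; rewrite andbT; lia.
by case: ifP => // ri; have -> : (i.+1 == r) = false by lia.
Qed.

Lemma strip_sum_top u c : (forall i, (i <= N)%N -> (u i < b)%N) ->
  strip_sum N.+1 u c = if c is 0 then Phi u g else 0.
Proof.
move=> ub; rewrite /strip_sum.
have H (v : {ffun 'I_N.+1 -> 'I_b}) : pstrip N.+1 u v c =
   [forall i : 'I_N.+1, v i == u i :> nat] && (c == 0%N).
  rewrite /pstrip; have -> : [forall i : 'I_N.+1, if (i < N.+1)%N then v i == u i :> nat else
     (v i <= u i)%N && ((i < N)%N ==> (u i.+1 < v i)%N)] = [forall i : 'I_N.+1, v i == u i :> nat].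
    by apply: eq_forallb => i; rewrite ltn_ord.
  case: (boolP [forall i : 'I_N.+1, _]) => //= /forallP vu.
  have -> : tot N (ext v) = tot N u by rewrite tot_ext; apply: eq_bigr => i _; exact/eqP.
  by rewrite -{2}[tot N u]addn0 eqn_add2l.
case: c H => [|c] H; last by rewrite big1 // => v; rewrite H andbF.
pose v0 : {ffun 'I_N.+1 -> 'I_b} := [ffun i : 'I_N.+1 => Ordinal (ub i (leq_ord i))].
rewrite (big_pred1 v0) => [|v].
  by apply: (mext HM) => i iN; rewrite /ext ffunE /= inordK.
rewrite H andbT; apply/forallP/eqP => [vu|-> i]; last by rewrite ffunE.
by apply/ffunP => i; apply: val_inj; rewrite ffunE /=; exact/eqP.
Qed.

Lemma low_bound u r : (forall i, (i <= N)%N -> (u i < b)%N) ->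
  forall i, (i <= N)%N -> (low u r i < b)%N.
Proof. by move=> ub i iN; rewrite /low; case: ifP => _; have := ub i iN; lia. Qed.

(** Pieri's rule: the divided difference of ['X^(c + k)] is the complete homogeneous polynomial of
    degree [c], and the two terms of [Psi_X] match those of [strip_sum_split]. *)
Lemma Psi_strips k : (k <= N)%N -> forall c u, strict N u ->
  (forall i, (i <= N)%N -> (u i < b)%N) ->
  Psi N y Phi k u ('X^(c + k) * g%:P) = strip_sum (N - k)%N u c.
Proof.
have fixX e i : (i < N)%N -> map_poly (tau i) ('X^e * g%:P) = 'X^e * g%:P.
  by move=> iN; rewrite rmorphM /= map_polyXn map_polyC /= fixg.
have yterm j c u : (j <= N)%N -> strict N u -> (forall i, (i <= N)%N -> (u i < b)%N) ->
  (forall u, strict N u -> (forall i, (i <= N)%N -> (u i < b)%N) ->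
   Psi N y Phi j u ('X^(c + j) * g%:P) = strip_sum (N - j)%N u c) ->
  Psi N y Phi j u ((y (N - j)%N)%:P * ('X^(c + j) * g%:P)) =
  (if blocked N u (N - j)%N then 0 else strip_sum (N - j)%N (low u (N - j)%N) c).
  move=> jN su ub IH; case: ifP => [bl|/negbT nb].
    by rewrite (Psi_blocked HM) // => j0; apply: fixX; lia.
  have [sl ur] := strict_low su (leq_subr _ _) nb.
  by rewrite (Psi_low HM) ?leq_subr // IH //; apply: low_bound.
elim: k => [|k IHk] kN.
  elim=> [|c IHc] u su ub.
    rewrite mul1r subn0 strip_sum_split // strip_sum_top // addr0.
    by rewrite /Psi /= hornerC.
  rewrite subn0 strip_sum_split // strip_sum_top // add0r addSn exprS -mulrA.
  rewrite (Psi_X HM) subn0 (Psi_sub0 HM) add0r.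
  by have := yterm 0%N c u kN su ub; rewrite subn0; apply=> w sw wb; rewrite IHc // subn0.
elim=> [|c IHc] u su ub.
  rewrite add0n exprS -mulrA (Psi_X HM) Psi_sub //.
  have -> : Psi N y Phi k.+1 u ((y (N - k.+1)%N)%:P * ('X^k * g%:P)) = 0.
    apply: (Psi_small HM); rewrite (leq_trans (size_const_mul _ _)) //.
    rewrite mulrC (leq_trans (size_const_mul _ _)) // size_polyXn //.
  rewrite addr0 -[k]add0n IHk ?(ltnW kN) // add0n.
  rewrite [RHS]strip_sum_split ?leq_subr // addr0; congr strip_sum; lia.
rewrite addSn exprS -mulrA (Psi_X HM) yterm // Psi_sub //.
rewrite addnS -addSn IHk ?(ltnW kN) //.
rewrite [RHS]strip_sum_split ?leq_subr //; congr (strip_sum _ _ _ + _); lia.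
Qed.

End Strips.

Lemma strict_le0 N u : strict N u -> forall i, (i <= N)%N -> (u i <= u 0)%N.
Proof.
move=> su; elim=> [|i IH] iN //.
by apply: leq_trans (IH (ltnW iN)); apply: ltnW; apply: su.
Qed.

(** * Passing to the boundary of the cone *)

Section Limit.
Variable R : realFieldType.

Lemma poly_pos_near0 (p : {poly R}) : 0 < p.[0] ->
  exists2 d, 0 < d & forall e, 0 < e < d -> 0 < p.[e].
Proof.
move=> p0; have [q pE] : exists q, p = q * 'X + (p.[0])%:P.
  have /factor_theorem[q qE] : root (p - p.[0]%:P) 0 by rewrite rootE !hornerE subrr.
  by exists q; rewrite -[p in LHS](subrK (p.[0])%:P) qE subr0.
have [M qM] := poly_itv_bound q 0 1.
have M0 : 0 <= M by apply: le_trans (qM 0 _); rewrite ?normr_ge0 // lexx ler01.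
have M1 : 0 < M + 1 by rewrite ltr_wpDl.
exists (Num.min 1 (p.[0] / (M + 1))); first by rewrite lt_min ltr01 divr_gt0.
move=> e /andP[e0]; rewrite lt_min => /andP[e1]; rewrite ltr_pdivlMr // => eM.
rewrite pE !hornerE -ltrBlDr sub0r.
have /ler_normlP[qe _] : `|q.[e]| <= M by rewrite qM // !ltW.
have : e * - q.[e] <= e * M by rewrite ler_pM2l.
lra.
Qed.

Variables (N : nat) (B : comNzRingType) (io : {rmorphism R -> B}) (y : nat -> B).
Variables (Phi : (nat -> nat) -> B -> R) (tau : nat -> {rmorphism B -> B}).
Variables (C V : B -> Prop) (sh : nat).
Hypothesis HM : hodge_model N io y Phi tau C V sh.
Variable d0 : B.

Lemma limit_poly u s g :
  exists p : {poly R}, forall e, Phi u (\prod_(h <- s) (h + io e * d0) * g) = p.[e].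
Proof.
have [TD TZ] := mphi HM u.
elim: s g => [|h s IH] g.
  by exists (Phi u g)%:P => e; rewrite big_nil mul1r hornerC.
have [p1 E1] := IH (h * g); have [p2 E2] := IH (d0 * g).
exists (p1 + 'X * p2) => e; rewrite !hornerE -E1 -E2 -TZ -TD big_cons.
by congr (Phi u); ring.
Qed.

(** The positivity assumption and a strict failure of the inequality are both positivity conditions
    on polynomials at [e = 0], so they would persist for small [e > 0], where the factors lie in
    [C]. *)
Lemma hodge_limit u s : strict N u ->
  ((size s).+2 + tot N (staircase N) = tot N u + sh)%N ->
  (forall h e, h \in s -> 0 < e -> C (h + io e * d0)) ->
  hodge V (fun g => Phi u (\prod_(h <- s) h * g)).
Proof.
move=> su sE Cs x z Vx Vz.
have [pxx Exx] := limit_poly u s (x * x).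
have [pxz Exz] := limit_poly u s (x * z).
have [pzz Ezz] := limit_poly u s (z * z).
have E0 g : Phi u (\prod_(h <- s) h * g) = Phi u (\prod_(h <- s) (h + io 0 * d0) * g).
  by congr (Phi u (_ * _)); apply: eq_bigr => h _; rewrite rmorph0 mul0r addr0.
rewrite !E0 Exx Exz Ezz => xx0; rewrite leNgt; apply/negP => lt.
have w0 : 0 < (pxx * pzz - pxz ^+ 2).[0] by rewrite !hornerE subr_gt0.
have [d1 d1_0 H1] := poly_pos_near0 xx0; have [d2 d2_0 H2] := poly_pos_near0 w0.
pose e := Num.min d1 d2 / 2%:R.
have m0 : 0 < Num.min d1 d2 by rewrite lt_min d1_0.
have e0 : 0 < e by rewrite divr_gt0.
have em : e < Num.min d1 d2 by rewrite ltr_pdivrMr // ltr_pMr // ltr1n.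
move: em; rewrite lt_min => /andP[e1 e2].
have := H1 e; rewrite e0 e1 => /(_ isT) h1.
have := H2 e; rewrite e0 e2 => /(_ isT); rewrite !hornerE subr_gt0 ltNge => /negP; apply.
have := mhodge HM su (Ds := [seq h + io e * d0 | h <- s]).
rewrite size_map big_map => /(_ _ sE) H.
rewrite -Exx -Ezz -Exz; apply: H => //; last by rewrite Exx.
elim: s Cs {sE Exx Exz Ezz E0} => //= h s IH Cs; split.
  by apply: Cs; rewrite // inE eqxx.
by apply: IH => h' e' hs; apply: Cs; rewrite inE hs orbT.
Qed.
End Limit.

Lemma base_kt (R : realFieldType) N u : strict N u ->
  mphi0 (N := N) u 1 = [forall i : 'I_N.+1, u i == (N - i)%N]%:R :> R.
Proof.
move=> su; case: (boolP [forall i : 'I_N.+1, _]) => [/forallP H|].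
  rewrite -(mphi0_one R N); apply: mphi0_ext => i iN.
  have iN' : (i < N.+1)%N by [].
  by have /eqP := H (Ordinal iN').
move=> nst; apply: mphi0_big; rewrite ltnNge; apply: contra nst => u0.
apply/forallP => i; have iN : (i <= N)%N by rewrite -ltnS.
rewrite eqn_leq strict_ge // andbT.
have H j : (j <= N)%N -> (u j <= N - j)%N.
  elim: j => [|j IHj] jN; first by rewrite subn0.
  by have := su j jN; have := IHj (ltnW jN); lia.
exact: H.
Qed.

(** [d0] points from the boundary classes [eta l] into the cone. Membership of its own positive
    multiples is carried along because the new variable is perturbed to [e d0 + (1 + e) X]. *)
Theorem kostka_model (R : realFieldType) N n :
  exists (B : comNzRingType) (io : {rmorphism R -> B}) (y : nat -> B)
    (Phi : (nat -> nat) -> B -> R) (tau : nat -> {rmorphism B -> B})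
    (C V : B -> Prop) (d0 : B) (eta : nat -> B),
  [/\ hodge_model N io y Phi tau C V (n * N),
      forall l e, (l < n)%N -> 0 < e -> C (eta l + io e * d0),
      forall e, 0 < e -> C (io e * d0),
      forall l i : nat, (l < n)%N -> (i < N)%N -> tau i (eta l) = eta l &
      (forall l, (l < n)%N -> V (eta l)) /\
      forall u (mu : nat -> nat), strict N u ->
        Phi u (\prod_(l < n) eta l ^+ (mu l + N)) = (kt N n u mu)%:R].
Proof.
elim: n => [|n [B [io [y [Phi [tau [C [V [d0 [eta [HM Ce Cd te [Ve K]]]]]]]]]]]].
  exists _, (mio R N), (mvar R N), (@mphi0 R N), (mtau R N),
    (sigma_cone N (mio R N) (mvar R N)), (linforms N (mio R N) (mvar R N)),
    (sigma N (mvar R N)), (fun=> 0).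
  split; [exact: mpoly_model | by [] | by move=> e e0; exists e | by [] | split=> //].
  by move=> u mu su; rewrite big_ord0 base_kt.
exists _, (polyC \o io), (fun i => (y i)%:P), (Psi N y Phi N),
  (fun i => map_poly (tau i)), (cone_step io C), (space_step io V), (d0%:P + 'X), (fun l => if l == n then 'X else (eta l)%:P).
have := step_model HM; rewrite addnC -mulSn => HM'.
split; first exact: HM'.
- move=> l e; rewrite ltnS => ln e0 /=; case: (eqVneq l n) => [_|l_n].
    exists (io e * d0), (1 + e); split; [exact: Cd | by rewrite ltr_wpDr ?ltW | ].
    by rewrite !rmorphM rmorphD rmorph1 /=; ring.
  exists (eta l + io e * d0), e; split=> //; first by apply: Ce => //; rewrite ltn_neqAle l_n.
  by rewrite rmorphD rmorphM /=; ring.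
- move=> e e0; exists (io e * d0), e; split=> //; first exact: Cd.
  by rewrite rmorphM /=; ring.
- move=> l i; rewrite ltnS => ln iN; case: (eqVneq l n) => [_|l_n]; first by rewrite /= map_polyX.
  by rewrite /= map_polyC /= te // ltn_neqAle l_n.
split.
  move=> l; rewrite ltnS => ln; case: (eqVneq l n) => [_|l_n].
    exists 0, 1; split; first exact: (space0 HM).
    by rewrite !rmorph1 rmorph0 mul1r add0r.
  by exists (eta l), 0; rewrite rmorph0 mul0r addr0; split=> //; apply: Ve; rewrite ltn_neqAle l_n.
move=> u mu su; rewrite big_ord_recr /= eqxx mulrC.
set g := \prod_(l < n) eta l ^+ (mu l + N).
have -> : \prod_(i < n) (if i == n :> nat then 'X else (eta i)%:P) ^+ (mu i + N) = g%:P.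
  rewrite /g rmorph_prod; apply: eq_bigr => i _; rewrite ifN ?rmorphXn //.
  by rewrite neq_ltn ltn_ord.
have fixg i : (i < N)%N -> tau i g = g.
  move=> iN; rewrite /g rmorph_prod; apply: eq_bigr => l _.
  by rewrite rmorphXn /= te.
rewrite (Psi_strips HM fixg (b := (u 0%N).+1)) ?subnn //; last first.
  by move=> i iN; rewrite ltnS (strict_le0 su).
rewrite /strip_sum natr_sum; apply: eq_bigr => v sv.
by rewrite K //; apply: strict_strip sv.
Qed.

Definition bump2 (nu : nat -> nat) i j := fun l : nat => (nu l + (l == i) + (l == j))%N.

Definition kostka_form (R : realFieldType) N n u nu (x z : 'I_n -> R) : R :=
  \sum_(i < n) \sum_(j < n) x i * z j * (kt N n u (bump2 nu i j))%:R.

(** [hodge_limit] with each [eta l] repeated [nu l + N] times as a factor; two linear forms in the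
    [eta l] supply the exponents [e_i + e_j]. *)
Lemma kostka_form_hodge (R : realFieldType) N n u (nu : nat -> nat) (x z : 'I_n -> R) : strict N u ->
  ((\sum_(l < n) nu l).+2 + tot N (staircase N) = tot N u)%N ->
  0 < kostka_form N u nu x x ->
  kostka_form N u nu x x * kostka_form N u nu z z <= kostka_form N u nu x z ^+ 2.
Proof.
move=> su nuE.
have [B [io [y [Phi [tau [C [V [d0 [eta [HM Ce _ _ [Ve K]]]]]]]]]]] := kostka_model R N n.
pose s := flatten (map (fun l : 'I_n => nseq (nu l + N) (eta l)) (enum 'I_n)).
have sP : \prod_(h <- s) h = \prod_(l < n) eta l ^+ (nu l + N).
  rewrite /s big_flatten /= big_map big_enum /=; apply: eq_bigr => l _.
  by rewrite big_nseq iter_mulr_1.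
have sS : size s = (\sum_(l < n) nu l + n * N)%N.
  rewrite /s size_flatten /shape -map_comp sumnE big_map big_enum /=.
  under eq_bigr => l _ do rewrite size_nseq.
  by rewrite big_split /= sum_nat_const card_ord.
have sC h e : h \in s -> 0 < e -> C (h + io e * d0).
  move=> /flatten_mapP[l _]; rewrite mem_nseq => /andP[_ /eqP->]; exact: Ce.
have H := hodge_limit HM su _ sC.
have fP : functional io (fun g => Phi u (\prod_(h <- s) h * g)).
  exact/functional_mul/(mphi HM).
pose vec (x : 'I_n -> R) := \sum_(i < n) io (x i) * eta i.
have V0 : V 0 := space0 HM.
have Vvec x' : V (vec x').
  rewrite /vec; elim/big_rec: _ => // i g _ Vg; rewrite addrC; apply: (mV HM) => //; exact: Ve.
have QE x1 x2 : Phi u (\prod_(h <- s) h * (vec x1 * vec x2)) = kostka_form N u nu x1 x2.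
  rewrite /kostka_form /vec mulr_suml (functional_sum fP); apply: eq_bigr => i _.
  rewrite mulr_sumr (functional_sum fP); apply: eq_bigr => j _.
  have -> : io (x1 i) * eta i * (io (x2 j) * eta j) = io (x1 i * x2 j) * (eta i * eta j).
    by rewrite rmorphM; ring.
  rewrite fP.2 -K // sP; congr (_ * Phi u _); rewrite mulrA.
  have one (k : 'I_n) : eta k = \prod_(l < n) eta l ^+ (l == k :> nat).
    rewrite (bigD1 k) //= eqxx big1 ?mulr1 // => l /negPf lk.
    by rewrite -val_eqE /= in lk; rewrite lk.
  rewrite {1}[eta i]one [eta j]one -!big_split /=; apply: eq_bigr => l _.
  by rewrite -!exprD; congr (_ ^+ _); rewrite /bump2; lia.
rewrite -!QE; apply: H => //.
by rewrite sS; lia.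
Qed.

(** * Tableaux as chains of horizontal strips *)

Section Tableaux.
Local Open Scope nat_scope.

Lemma box_inj la (b1 b2 : box la) :
  box_row b1 = box_row b2 -> box_col b1 = box_col b2 -> b1 = b2.
Proof.
case: b1 b2 => [i1 j1] [i2 j2]; rewrite /box_row /box_col /= => /val_inj E.
by subst i2 => /val_inj ->.
Qed.

(** Natural coordinates allow tableaux of different shapes to be compared without transport between
    their box types. *)
Definition entry la n (T : {ffun box la -> 'I_n}) r c : nat :=
  if [pick b | (box_row b == r) && (box_col b == c)] is Some b then T b else n.

Lemma entryE la n (T : {ffun box la -> 'I_n}) b : entry T (box_row b) (box_col b) = T b.
Proof.
rewrite /entry; case: pickP => [b' /andP[/eqP r /eqP c]|/(_ b)]; last by rewrite !eqxx.
by rewrite (box_inj r c).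
Qed.

Lemma mkbox la r c : r < size la -> c < nth 0 la r ->
  exists b : box la, box_row b = r /\ box_col b = c.
Proof. by move=> rs cs; exists (existT _ (Ordinal rs) (Ordinal cs)). Qed.

Lemma box_row_lt la (b : box la) : box_row b < size la.
Proof. exact: ltn_ord. Qed.

Lemma box_col_lt la (b : box la) : box_col b < nth 0 la (box_row b).
Proof. exact: ltn_ord. Qed.

Definition filling la n (g : nat -> nat -> nat) : Prop :=
  [/\ forall r c, r < size la -> c < nth 0 la r -> g r c < n,
      forall r c c', r < size la -> c < c' -> c' < nth 0 la r -> g r c <= g r c' &
      forall r r' c, r < r' -> r' < size la -> c < nth 0 la r -> c < nth 0 la r' ->
        g r c < g r' c].

Definition weight la (g : nat -> nat -> nat) l :=
  \sum_(r < size la) \sum_(c < nth 0 la r) (g r c == l).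

Lemma filling_entry la n (T : {ffun box la -> 'I_n}) : is_tableau T -> filling la n (entry T).
Proof.
move=> /forallP H; split.
- by move=> r c rs cs; have [b [<- <-]] := mkbox rs cs; rewrite entryE.
- move=> r c c' rs cc' cs; have [b' [rb' cb']] := mkbox rs cs.
  have [b [rb cb]] := mkbox rs (ltn_trans cc' cs).
  have /forallP/(_ b')/andP[/implyP h _] := H b.
  move: h; rewrite rb rb' cb cb' eqxx => /(_ cc').
  by rewrite -!entryE rb rb' cb cb'.
- move=> r r' c rr' rs cs cs'; have [b' [rb' cb']] := mkbox rs cs'.
  have [b [rb cb]] := mkbox (ltn_trans rr' rs) cs.
  have /forallP/(_ b')/andP[_ /implyP h] := H b.
  move: h; rewrite rb rb' cb cb' eqxx => /(_ rr').
  by rewrite -!entryE rb rb' cb cb'.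
Qed.

Lemma tableau_filling la n (T : {ffun box la -> 'I_n}) g : filling la n g ->
  (forall b, T b = g (box_row b) (box_col b) :> nat) -> is_tableau T.
Proof.
move=> [_ hr hc] Tg; apply/forallP => b; apply/forallP => b'; apply/andP; split; apply/implyP.
  move=> /andP[/eqP rb cb]; rewrite !Tg -rb; apply: hr => //; first exact: box_row_lt.
  by rewrite rb; exact: box_col_lt.
move=> /andP[/eqP cb rb]; rewrite !Tg -cb; apply: hc => //; first exact: box_row_lt.
  exact: box_col_lt.
by rewrite cb; exact: box_col_lt.
Qed.

Lemma weight_tableau la n (T : {ffun box la -> 'I_n}) g (l : 'I_n) :
  (forall b, T b = g (box_row b) (box_col b) :> nat) ->
  #|[set b | T b == l]| = weight la g l.
Proof.
move=> Tg; rewrite -sum1dep_card /weight sig_big_dep /= big_mkcond /=.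
by apply: eq_bigr => b _; rewrite -val_eqE /= Tg; case: (_ == _).
Qed.

Lemma entry_ext la n (T T' : {ffun box la -> 'I_n}) :
  (forall r c, r < size la -> c < nth 0 la r -> entry T r c = entry T' r c) -> T = T'.
Proof.
move=> e; apply/ffunP => b; apply: val_inj; rewrite /= -!entryE; apply: e.
  exact: box_row_lt.
exact: box_col_lt.
Qed.

Definition mktab la n (g : nat -> nat -> nat) : {ffun box la -> 'I_n.+1} :=
  [ffun b => inord (g (box_row b) (box_col b))].

(** Used to recover which cells of a weakly increasing row lie below a threshold from their
    number. *)
Lemma count_prefix L (P : nat -> bool) k : (forall c c', c < c' -> c' < L -> P c' -> P c) ->
  \sum_(c < L) P c = k -> forall c, c < L -> P c = (c < k).
Proof.
elim: L k => [|L IH] k mono //; rewrite big_ord_recr /= => sE c cL.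
have mono' c1 c2 : c1 < c2 -> c2 < L -> P c2 -> P c1.
  by move=> c12 c2L; apply: mono => //; apply: ltnW.
case PL: (P L) sE => sE.
  have Pall c1 : c1 < L -> P c1 by move=> c1L; apply: (mono c1 L).
  move: sE; rewrite (eq_bigr (fun=> 1)) => [|i _]; last by rewrite Pall.
  rewrite sum1_card card_ord addn1 => <-; rewrite cL.
  by move: cL; rewrite ltnS leq_eqVlt => /orP[/eqP->|/Pall].
rewrite addn0 in sE; move: cL; rewrite ltnS leq_eqVlt => /orP[/eqP->|cL].
  rewrite PL -sE; apply/esym/negbTE; rewrite -leqNgt -[L in _ <= L]card_ord -sum1_card.
  by apply: leq_sum => i _; case: (P i).
exact: IH.
Qed.

Definition partition_of N (u : nat -> nat) := mkseq (fun i => u i - (N - i)) N.+1.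

Definition tableaux_of_weight la n (mu : nat -> nat) : {set {ffun box la -> 'I_n}} :=
  [set T | is_tableau T & [forall l : 'I_n, #|[set b | T b == l]| == mu l]].

Lemma size_partition_of N u : size (partition_of N u) = N.+1.
Proof. by rewrite size_mkseq. Qed.

Lemma nth_partition_of N u i : i <= N -> nth 0 (partition_of N u) i = u i - (N - i).
Proof. by move=> iN; rewrite nth_mkseq. Qed.

Section Remove.
Variables (N n : nat) (u : nat -> nat) (mu : nat -> nat).
Hypothesis su : strict N u.
Notation la := (partition_of N u).

Let la_i i : i <= N -> nth 0 la i + (N - i) = u i.
Proof. by move=> iN; rewrite nth_partition_of // subnK //; apply: strict_ge. Qed.

Lemma partition_of_decr r r' : r <= r' -> r' <= N -> nth 0 la r' <= nth 0 la r.
Proof.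
move=> rr'; elim: r' rr' => [|r' IH]; first by rewrite leqn0 => /eqP->.
rewrite leq_eqVlt => /orP[/eqP->//|]; rewrite ltnS => /IH h r'N.
apply: leq_trans (h (ltnW r'N)); have := la_i r'N; have := la_i (ltnW r'N); have := su r'N.
lia.
Qed.

(** The shape that remains after deleting the largest letter [n], in the strict encoding. *)
Definition low_rows (T : {ffun box la -> 'I_n.+1}) : {ffun 'I_N.+1 -> 'I_(u 0).+1} :=
  [ffun i : 'I_N.+1 => inord ((N - i) + \sum_(c < nth 0 la i) (entry T i c < n))].

Lemma low_rowsE T (i : 'I_N.+1) :
  low_rows T i = (N - i) + \sum_(c < nth 0 la i) (entry T i c < n) :> nat.
Proof.
rewrite ffunE inordK // ltnS; have iN : i <= N by rewrite -ltnS.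
apply: leq_trans (strict_le0 su iN); rewrite -(la_i iN) addnC leq_add2r.
rewrite -[leqRHS]card_ord -sum1_card; apply: leq_sum => c _.
by case: (_ < _).
Qed.

Lemma sum_ltn_prefix L k : k <= L -> \sum_(c < L) (c < k) = k.
Proof.
move=> kL; rewrite -(big_mkord xpredT (fun c => (c < k) : nat)) (big_cat_nat (n := k)) //=.
rewrite (eq_big_nat _ _ (F2 := fun=> 1)) => [|i /andP[_ ->]//].
rewrite sum_nat_const_nat subn0 muln1 big_nat_cond big1 ?addn0 // => i.
by rewrite andbT => /andP[ki _]; rewrite ltnNge ki.
Qed.

Lemma low_rows_strip T : T \in tableaux_of_weight la n.+1 mu -> pstrip 0 u (low_rows T) (mu n).
Proof.
rewrite inE => /andP[/filling_entry[hb hr hc] /forallP/(_ ord_max)/eqP].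
rewrite (@weight_tableau _ _ _ (entry T)) => [wn|b]; last by rewrite entryE.
have sz : size la = N.+1 by apply: size_partition_of.
have le1 L (P : 'I_L -> bool) : \sum_(c < L) P c <= L.
  by rewrite -[leqRHS]card_ord -sum1_card; apply: leq_sum => c _; case: (P c).
apply/andP; split.
  apply/forallP => i /=; have iN : i <= N by rewrite -ltnS.
  rewrite low_rowsE -{1}(la_i iN) addnC leq_add2r le1 /=; apply/implyP => iN'.
  rewrite -(la_i iN').
  (* A cell of row [i] above a cell of row [i.+1] cannot hold the largest letter, columns being
     strict. *)
  have : nth 0 la i.+1 <= \sum_(c < nth 0 la i) (entry T i c < n).
    rewrite -{1}(sum_ltn_prefix (partition_of_decr (leqnSn i) iN')).
    apply: leq_sum => c _; case: ltnP => // ci.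
    have := hc i i.+1 c (ltnSn _); rewrite sz => /(_ iN' (ltn_ord c) ci) lt.
    by have := hb i.+1 c; rewrite sz => /(_ iN' ci); rewrite ltnS => /(leq_trans lt) ->.
  have : N - i = (N - i.+1).+1 by lia.
  by move=> -> le; rewrite addnS ltnS leq_add2r.
rewrite tot_ext -wn /weight sz -big_split /=; apply/eqP.
apply: eq_bigr => i _; have iN : i <= N by rewrite -ltnS.
rewrite low_rowsE -(la_i iN) -addnA addnC; congr (_ + _).
rewrite -big_split /= -[RHS]card_ord -sum1_card; apply: eq_bigr => c _.
have := hb i c; rewrite sz => /(_ (ltn_ord i) (ltn_ord c)); rewrite ltnS leq_eqVlt.
by case: ltngtP.
Qed.

Section Fiber.
Variable v : {ffun 'I_N.+1 -> 'I_(u 0).+1}.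
Hypothesis sv : pstrip 0 u v (mu n).
Notation lav := (partition_of N (ext v)).

Let strict_v : strict N (ext v) := strict_strip su sv.

Let lav_i i : i <= N -> nth 0 lav i + (N - i) = ext v i.
Proof. by move=> iN; rewrite nth_partition_of // subnK //; apply: strict_ge. Qed.

Let lav_le i : i <= N -> nth 0 lav i <= nth 0 la i.
Proof.
move=> iN; rewrite -(leq_add2r (N - i)) lav_i // la_i //.
by have /andP[/forallP/(_ (inord i)) + _] := sv; rewrite inordK //= => /andP[].
Qed.

Let lav_ge i : i < N -> nth 0 la i.+1 <= nth 0 lav i.
Proof.
move=> iN; have := la_i iN; have := lav_i (ltnW iN); rewrite /ext.
have /andP[/forallP/(_ (inord i)) + _] := sv; rewrite inordK /=; last exact: ltnW.
by move=> /andP[_ /implyP/(_ iN)]; lia.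
Qed.

Let sz : size la = N.+1. Proof. exact: size_partition_of. Qed.
Let szv : size lav = N.+1. Proof. exact: size_partition_of. Qed.

Let grow (T : {ffun box lav -> 'I_n}) r c := if c < nth 0 lav r then entry T r c else n.

Let grow_filling (T : {ffun box lav -> 'I_n}) : is_tableau T -> filling la n.+1 (grow T).
Proof.
move=> /filling_entry[hb hr hc]; rewrite szv in hb hr hc.
rewrite /grow; split; rewrite ?sz.
- by move=> r c rN cr; case: ifP => // cr'; rewrite ltnS ltnW // hb.
- move=> r c c' rN cc' cr'; case: ifP => [cr|cr].
    by case: ifP => [c'v|_]; [apply: hr | rewrite ltnW // hb].
  by rewrite ifN // -leqNgt; move: cr => /negbT; rewrite -leqNgt => /leq_trans; apply; apply: ltnW.
- move=> r r' c rr' r'N cr cr'.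
  have cv : c < nth 0 lav r.
    apply: leq_trans (lav_ge (leq_trans rr' r'N)); apply: leq_trans cr' _.
    exact: partition_of_decr.
  rewrite cv; case: ifP => [cv'|_]; first exact: hc.
  by apply: hb => //; apply: ltn_trans rr' r'N.
Qed.

Let entry_grow (T : {ffun box lav -> 'I_n}) r c : is_tableau T -> r <= N -> c < nth 0 la r ->
  entry (mktab la n (grow T)) r c = grow T r c.
Proof.
move=> tT rN cr; have rs : r < size la by rewrite sz.
have [b [<- <-]] := mkbox rs cr.
rewrite entryE ffunE inordK //; have [hb _ _] := grow_filling tT.
by apply: hb; [exact: box_row_lt | exact: box_col_lt].
Qed.

Let weight_grow (T : {ffun box lav -> 'I_n}) l : is_tableau T -> l < n ->
  weight la (grow T) l = weight lav (entry T) l.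
Proof.
move=> tT ln; rewrite /weight sz szv; apply: eq_bigr => r _; have rN : r <= N by rewrite -ltnS.
rewrite -(big_mkord xpredT (fun c => (grow T r c == l) : nat)).
rewrite (big_cat_nat (n := nth 0 lav r)) //=; last exact: lav_le.
rewrite [X in _ + X]big_nat_cond [X in _ + X]big1 ?addn0.
  by rewrite big_mkord; apply: eq_bigr => c _; rewrite /grow ltn_ord.
move=> c; rewrite andbT /grow => /andP[vc _]; rewrite ltnNge vc /=.
by rewrite gtn_eqF.
Qed.

Let weight_grow_max (T : {ffun box lav -> 'I_n}) : is_tableau T ->
  weight la (grow T) n = mu n.
Proof.
move=> tT; have /andP[_ /eqP] := sv; rewrite /tot => tE.
apply: (@addnI (\sum_(i < N.+1) ext v i)); rewrite tE /weight sz -big_split /=.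
apply: eq_bigr => r _; have rN : r <= N by rewrite -ltnS.
rewrite -(la_i rN) -(lav_i rN) addnAC; congr (_ + _).
rewrite -(big_mkord xpredT (fun c => (grow T r c == n) : nat)).
rewrite (big_cat_nat (n := nth 0 lav r)) //=; last exact: lav_le.
rewrite big_nat_cond big1 ?add0n.
  rewrite (eq_big_nat _ _ (F2 := fun=> 1)) => [|c /andP[vc _]].
    by rewrite sum_nat_const_nat muln1 subnKC // lav_le.
  by rewrite /grow ltnNge vc eqxx.
move=> c; rewrite andbT /= /grow => cv; rewrite cv.
have [hb _ _] := filling_entry tT.
by rewrite ltn_eqF // hb // szv.
Qed.

Let grow_in T : T \in tableaux_of_weight lav n mu ->
  (mktab la n (grow T) \in tableaux_of_weight la n.+1 mu) && (low_rows (mktab la n (grow T)) == v).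
Proof.
rewrite inE => /andP[tT /forallP wT].
have fg := grow_filling tT; have Eg b : mktab la n (grow T) b = grow T (box_row b) (box_col b) :> nat.
  by rewrite ffunE inordK //; have [hb _ _] := fg; apply: hb; [exact: box_row_lt | exact: box_col_lt].
apply/andP; split.
  rewrite inE (tableau_filling fg Eg) /=; apply/forallP => l.
  rewrite (weight_tableau _ Eg); have [ln|] := ltnP l n.
    rewrite weight_grow //; have := wT (Ordinal ln).
    by rewrite (@weight_tableau _ _ _ (entry T)) // => b; rewrite entryE.
  move=> nl; have E : nat_of_ord l = n by apply/eqP; rewrite eqn_leq nl andbT -ltnS ltn_ord.
  by rewrite E weight_grow_max.
apply/eqP/ffunP => i; apply: val_inj; have iN : i <= N by rewrite -ltnS.
rewrite /= low_rowsE (eq_bigr (fun c : 'I_(nth 0 la i) => (c < nth 0 lav i) : nat)).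
  by rewrite sum_ltn_prefix ?lav_le // addnC lav_i // /ext inord_val.
move=> c _; rewrite entry_grow // /grow; case: ifP => [cv|_]; last by rewrite ltnn.
by have [hb _ _] := filling_entry tT; rewrite hb // szv.
Qed.

(** Filling the strip with [n] inverts the deletion; by [lav_ge] no two added cells share a column,
    so columns stay strict. *)
Lemma card_fiber :
  #|[set T in tableaux_of_weight la n.+1 mu | low_rows T == v]| = #|tableaux_of_weight lav n mu|.
Proof.
rewrite -(@card_in_imset _ _ (fun T => mktab la n (grow T))).
  apply: eq_card => T; apply/idP/imsetP; last first.
    by move=> [T' T'in ->]; rewrite inE grow_in.
  rewrite inE => /andP[Tin /eqP Tv]; have := Tin; rewrite inE => /andP[tT /forallP wT].
  have [hb hr hc] := filling_entry tT; rewrite sz in hb hr hc.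
  have small r c : r <= N -> c < nth 0 la r -> (entry T r c < n) = (c < nth 0 lav r).
    move=> rN; apply: (count_prefix (P := fun c => entry T r c < n)) => [c1 c2 c12 c2L|].
      by apply: leq_ltn_trans; apply: hr.
    have := low_rowsE T (inord r); rewrite Tv inordK //.
    by have := lav_i rN; rewrite /ext => <-; rewrite addnC => /addnI.
  have sb (b : box lav) : entry T (box_row b) (box_col b) < n.
    have rN : box_row b <= N by have := box_row_lt b; rewrite szv.
    rewrite small ?box_col_lt //; apply: leq_trans (box_col_lt b) (lav_le rN).
  pose T' : {ffun box lav -> 'I_n} := [ffun b => Ordinal (sb b)].
  have E' b : T' b = entry T (box_row b) (box_col b) :> nat by rewrite ffunE.
  have e' r c : r <= N -> c < nth 0 lav r -> entry T' r c = entry T r c.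
    move=> rN cr; have rs : r < size lav by rewrite szv.
    by have [b [<- <-]] := mkbox rs cr; rewrite entryE E'.
  have fT' : filling lav n (entry T).
    split; rewrite ?szv.
    - by move=> r c rN cr; rewrite small // (leq_trans cr) // lav_le.
    - by move=> r c c' rN cc' cr; apply: hr => //; rewrite (leq_trans cr) // lav_le.
    - move=> r r' c rr' r'N cr cr'; have rN : r <= N by rewrite -ltnS (ltn_trans rr').
      by apply: hc => //; [exact: leq_trans cr (lav_le rN) | exact: leq_trans cr' (lav_le r'N)].
  have tT' : is_tableau T' by apply: tableau_filling fT' E'.
  have gE r c : r <= N -> c < nth 0 la r -> grow T' r c = entry T r c.
    move=> rN cr; rewrite /grow; case: ifP => [cv|/negbT]; first exact: e'.
    rewrite -small // -leqNgt => le; apply/eqP; rewrite eqn_leq le.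
    by have := hb r c rN cr; rewrite ltnS.
  exists T'.
    rewrite inE tT' /=; apply/forallP => l.
    rewrite (@weight_tableau _ _ _ (entry T')) => [|b]; last by rewrite entryE.
    rewrite -weight_grow //; have := wT (widen_ord (leqnSn n) l).
    rewrite (@weight_tableau _ _ _ (entry T)) => [|b]; last by rewrite entryE.
    move=> /eqP <-; rewrite /weight sz; apply/eqP.
    apply: eq_bigr => r _; apply: eq_bigr => c _; rewrite gE //.
    by rewrite -ltnS.
  apply: entry_ext => r c; rewrite sz => rN cr.
  by rewrite entry_grow // gE.
move=> T1 T2; rewrite !inE => /andP[t1 _] /andP[t2 _] E.
apply: entry_ext => r c; rewrite szv => rN cr.
have cr' : c < nth 0 la r by rewrite (leq_trans cr) // lav_le.
by have := entry_grow t1 rN cr'; rewrite E entry_grow // /grow cr => ->.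
Qed.
End Fiber.
End Remove.

Lemma card_tableaux N n : forall u mu, strict N u ->
  #|tableaux_of_weight (partition_of N u) n mu| = kt N n u mu.
Proof.
elim: n => [|n IH] u mu su /=.
  have [/forallP H|] := boolP [forall i : 'I_N.+1, u i == N - i].
    have nob (b : box (partition_of N u)) : False.
      have := box_col_lt b; have := box_row_lt b; rewrite size_partition_of => rb.
      rewrite nth_partition_of //; have /eqP := H (Ordinal rb) => /= ->.
      by rewrite subnn.
    apply/eqP/cards1P; exists [ffun b => match nob b with end]; apply/setP => T.
    rewrite !inE; have -> : T = [ffun b => match nob b with end] by apply/ffunP => b; case: (nob b).
    rewrite eqxx; apply/andP; split; first by apply/forallP => b; case: (nob b).
    by apply/forallP => -[].
  rewrite negb_forall => /existsP[i ui]; apply/eqP; rewrite cards_eq0; apply/eqP/setP => T.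
  have iN : i <= N by rewrite -ltnS.
  have rs : i < size (partition_of N u) by rewrite size_partition_of.
  have cs : 0 < nth 0 (partition_of N u) i.
    by rewrite nth_partition_of // subn_gt0 ltn_neqAle eq_sym ui strict_ge.
  by have [b _] := mkbox rs cs; case: (T b).
rewrite -sum1_card (partition_big (@low_rows N n u) (fun v => pstrip 0 u v (mu n))) /=; last first.
  by move=> T; apply: low_rows_strip.
apply: eq_bigr => v sv; rewrite -IH; last exact: strict_strip sv.
rewrite -(card_fiber su sv) -sum1_card; apply: eq_bigl => T; by rewrite !inE.
Qed.

End Tableaux.

(** * The support *)

Section Support.
Local Open Scope nat_scope.

Definition part N (u : nat -> nat) i := if i <= N then u i - (N - i) else 0.
Definition Lam N u k := \sum_(i < k) part N u i.

Lemma LamS N u k : Lam N u k.+1 = Lam N u k + part N u k.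
Proof. by rewrite /Lam big_ord_recr. Qed.

Lemma part_decr N u i : strict N u -> part N u i.+1 <= part N u i.
Proof.
move=> su; rewrite /part; case: (ltnP i N) => [iN|]; last by [].
by rewrite (ltnW iN); have := su i iN; lia.
Qed.

Lemma partE N u i : strict N u -> i <= N -> part N u i + (N - i) = u i.
Proof. by move=> su iN; rewrite /part iN subnK // (strict_ge su). Qed.

Lemma Lam_total N u : strict N u -> Lam N u N.+1 + tot N (staircase N) = tot N u.
Proof.
move=> su; rewrite /Lam /tot -big_split /=; apply: eq_bigr => i _.
by apply: partE => //; rewrite -ltnS.
Qed.

Lemma part_decr_le N u i j : strict N u -> i <= j -> part N u j <= part N u i.
Proof.
move=> su; elim: j => [|j IH]; first by rewrite leqn0 => /eqP->.
rewrite leq_eqVlt => /orP[/eqP->//|]; rewrite ltnS => /IH; apply: leq_trans.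
exact: part_decr.
Qed.

Lemma Lam_concave N u x a b : strict N u ->
  Lam N u (x + a + b) + Lam N u x <= Lam N u (x + a) + Lam N u (x + b).
Proof.
move=> su; elim: b => [|b IH]; first by rewrite !addn0.
rewrite !addnS !LamS; have : part N u (x + a + b) <= part N u (x + b).
  by apply: part_decr_le => //; rewrite addnAC leq_addr.
by move: IH; lia.
Qed.

(* [u] encodes the partition [part N u], and [Lam N u] its partial sums; this is
   Rado's form of the dominance order. *)
Definition dom N n u (mu : nat -> nat) :=
  (forall S : nat -> bool, \sum_(l < n) S l * mu l <= Lam N u (\sum_(l < n) S l)) /\
  \sum_(l < n) mu l = Lam N u N.+1.

Lemma strip_partP N b u (v : {ffun 'I_N.+1 -> 'I_b}) c : strict N u -> strict N (ext v) ->
  pstrip 0 u v c <-> [/\ forall i, part N (ext v) i <= part N u i,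
    forall i, part N u i.+1 <= part N (ext v) i & Lam N (ext v) N.+1 + c = Lam N u N.+1].
Proof.
move=> su sv; have tu := Lam_total su; have tv := Lam_total sv.
split=> [/andP[/forallP H /eqP tE]|[h1 h2 tE]].
  have Hi i : i <= N -> (ext v i <= u i) && ((i < N) ==> (u i.+1 < ext v i)).
    by move=> iN; have := H (inord i); rewrite inordK.
  split=> [i|i|]; last by lia.
    by rewrite /part; case: (leqP i N) => // iN; have /andP[] := Hi i iN; lia.
  rewrite {1}/part; case: (ltnP i N) => // iN.
  have /andP[_] := Hi i (ltnW iN); rewrite iN /= => lt.
  by have := partE sv (ltnW iN); lia.
apply/andP; split; last by apply/eqP; lia.
apply/forallP => i /=; have iN : i <= N by rewrite -ltnS.
have vi : v i = ext v i :> nat by rewrite /ext inord_val.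
rewrite vi -(partE sv iN) -{1}(partE su iN) leq_add2r h1 /=; apply/implyP => iN'.
by rewrite -(partE su iN'); have := h2 i; lia.
Qed.

Lemma Lam_beyond N u k : Lam N u (N.+1 + k) = Lam N u N.+1.
Proof.
elim: k => [|k IH]; first by rewrite addn0.
have kN : (N.+1 + k <= N) = false by lia.
by rewrite addnS LamS IH /part kN addn0.
Qed.

(** Removing a strip of size [c] leaves partial sums at most [minn (Lam N u k) (Lam N u k.+1 - c)],
    and some strip attains this for all [k] at once. *)
Lemma kt_dom N n : forall u mu, strict N u -> 0 < kt N n u mu <-> dom N n u mu.
Proof.
elim: n => [|n IH] u mu su.
  rewrite /= lt0b; split=> [/forallP H|[_]].
    have p0 i : part N u i = 0.
      rewrite /part; case: (leqP i N) => // iN; have iN' : i < N.+1 by [].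
      by have /eqP := H (Ordinal iN') => /= ->; rewrite subnn.
    split=> [S|]; first by rewrite !big_ord0.
    by rewrite big_ord0 /Lam big1.
  rewrite big_ord0 => /esym/eqP; rewrite sum_nat_eq0 => /forallP H.
  apply/forallP => i; have iN : i <= N by rewrite -ltnS.
  have := H i; rewrite /= => /eqP p0; rewrite -(partE su iN) p0 add0n //.
rewrite /= lt0n sum_nat_eq0 negb_forall; split.
  move=> /existsP[v]; rewrite negb_imply => /andP[sv]; rewrite -lt0n.
  have ssv := strict_strip su sv; have [h1 h2 tE] := (strip_partP _ su ssv).1 sv.
  move=> /(IH _ _ ssv)[dS dT]; split; last by rewrite big_ord_recr /= dT.
  have L1 k : Lam N (ext v) k <= Lam N u k by apply: leq_sum => i _.
  have L2 k : Lam N (ext v) k + mu n <= Lam N u k.+1.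
    have [kN|Nk] := leqP k N.+1; last first.
      by rewrite -(subnKC (ltnW Nk)) -addnS !Lam_beyond tE.
    (* Downward induction on [k] from [N.+1], where the totals agree. *)
    move: kN => /subnKC; move: (N.+1 - k) => j; elim: j k => [|j IHj] k kE.
      by rewrite addn0 in kE; rewrite kE tE -[N.+2]addn1 Lam_beyond.
    have := IHj k.+1; rewrite addSnnS => /(_ kE); rewrite !LamS.
    by have := h2 k; lia.
  move=> S; rewrite !big_ord_recr /=; case: (S n); last first.
    by rewrite !addn0; apply: leq_trans (dS S) (L1 _).
  by rewrite mul1n addn1; apply: leq_trans (L2 _); rewrite leq_add2r.
move=> [dS dT]; set c := mu n.
have c1 : c <= Lam N u 1.
  have := dS (fun l => l == n); rewrite !big_ord_recr /= eqxx mul1n.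
  rewrite !big1 //; first by move=> i _; rewrite ltn_eqF.
  by move=> i _; rewrite ltn_eqF.
have LS k : Lam N u 1 <= Lam N u k.+1.
  by elim: k => [|k IHk] //; rewrite [Lam N u k.+2]LamS; apply: leq_trans IHk (leq_addr _ _).
(* The strip is removed from the lowest rows possible: [M] is the sequence of partial
   sums of what is left. *)
pose M k := minn (Lam N u k) (Lam N u k.+1 - c).
have pd k : part N u k.+1 <= part N u k by apply: part_decr.
have M1 k : M k + part N u k.+1 <= M k.+1 <= M k + part N u k.
  rewrite /M; have := leq_trans c1 (LS k); have := leq_trans c1 (LS k.+1); have := pd k.
  by rewrite !LamS; lia.
have M0 : M 0 = 0 by rewrite /M /Lam big_ord0 min0n.
pose q k := M k.+1 - M k.
pose v : {ffun 'I_N.+1 -> 'I_(u 0).+1} := [ffun i : 'I_N.+1 => inord (q i + (N - i))].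
have qk k : part N u k.+1 <= q k <= part N u k by have := M1 k; rewrite /q; lia.
have vE i : i <= N -> ext v i = q i + (N - i).
  move=> iN; rewrite /ext ffunE inordK inordK //.
  by rewrite ltnS; apply: leq_trans (strict_le0 su iN); rewrite -(partE su iN) leq_add2r; have /andP[] := qk i.
have sv : strict N (ext v).
  move=> i iN; rewrite !vE // ?(ltnW iN) //; have := qk i; have := qk i.+1; lia.
have pv i : part N (ext v) i = q i.
  rewrite /part; case: (leqP i N) => iN; first by rewrite vE // addnK.
  have p0 : part N u i = 0 by rewrite /part leqNgt iN.
  by have := qk i; rewrite p0 leqn0 => /andP[_ /eqP->].
have LM k : Lam N (ext v) k = M k.
  elim: k => [|k IHk]; first by rewrite /Lam big_ord0 M0.
  by rewrite LamS IHk pv /q; have := M1 k; lia.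
have MT : M N.+1 + c = Lam N u N.+1.
  rewrite /M -[N.+2]addn1 Lam_beyond; have := LS N; lia.
apply/existsP; exists v; rewrite negb_imply; apply/andP; split.
  apply/(strip_partP _ su sv); split=> [i|i|]; rewrite ?pv ?LM //.
    by have /andP[] := qk i.
  by have /andP[] := qk i.
rewrite -lt0n; apply/IH => //; split; last first.
  by apply/eqP; rewrite -(eqn_add2r c) LM MT -dT big_ord_recr.
move=> S; rewrite LM /M leq_min.
have ext_sum (F : nat -> nat) (x : bool) :
    \sum_(l < n) (if l == n :> nat then x else S l) * F l = \sum_(l < n) S l * F l.
  by apply: eq_bigr => l _; rewrite ltn_eqF.
have ext_card (x : bool) : \sum_(l < n) (if l == n :> nat then x else S l) = \sum_(l < n) S l.
  by apply: eq_bigr => l _; rewrite ltn_eqF.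
(* The two bounds come from the test sets without and with the letter [n]. *)
apply/andP; split.
  have := dS (fun l => if l == n then false else S l).
  by rewrite !big_ord_recr /= eqxx ext_sum ext_card mul0n !addn0.
have := dS (fun l => if l == n then true else S l).
rewrite !big_ord_recr /= eqxx ext_sum ext_card mul1n addn1 -/c.
by move=> H; rewrite -(leq_add2r c) subnK // (leq_trans (leq_addl _ _) H).
Qed.

(** * The exchange property of integer points of a base polytope *)

Section Exchange.
Variables (n : nat) (f : nat -> nat).
Hypothesis f0 : f 0 = 0.
Hypothesis f_concave : forall x a b, f (x + a + b) + f x <= f (x + a) + f (x + b).
Implicit Types (X Y S : {set 'I_n}).

Definition base_point (a : 'I_n -> nat) :=
  (forall S, \sum_(i in S) a i <= f #|S|) /\ \sum_i a i = f n.

Lemma f_submodular X Y : f #|X :|: Y| + f #|X :&: Y| <= f #|X| + f #|Y|.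
Proof.
have h := f_concave #|X :&: Y| #|X :\: Y| #|Y :\: X|.
have E1 : #|X :&: Y| + #|X :\: Y| = #|X| by rewrite cardsID.
have E2 : #|X :&: Y| + #|Y :\: X| = #|Y| by rewrite setIC cardsID.
have E3 : #|X| + #|Y :\: X| = #|X :|: Y|.
  by have := cardsUI X Y; lia.
by rewrite E1 E3 E2 in h.
Qed.

Lemma sumUI (a : 'I_n -> nat) X Y :
  \sum_(i in X :|: Y) a i + \sum_(i in X :&: Y) a i = \sum_(i in X) a i + \sum_(i in Y) a i.
Proof.
rewrite !(big_mkcond (fun i => i \in _)) -!big_split /=; apply: eq_bigr => i _.
by rewrite !inE; case: (i \in X); case: (i \in Y); rewrite /= ?addn0 ?add0n.
Qed.

Lemma sum_setT (F : 'I_n -> nat) : \sum_(k in [set: 'I_n]) F k = \sum_k F k.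
Proof. by apply: eq_bigl => k; rewrite inE. Qed.

Definition tight a X := \sum_(i in X) a i == f #|X|.

Lemma tightUI a X Y : base_point a -> tight a X -> tight a Y ->
  tight a (X :|: Y) && tight a (X :&: Y).
Proof.
move=> [h _] /eqP tX /eqP tY; rewrite /tight.
have := h (X :|: Y); have := h (X :&: Y); have := sumUI a X Y; have := f_submodular X Y.
by lia.
Qed.

Definition transfer (a : 'I_n -> nat) i j := fun k => (a k - (k == i)) + (k == j).

(** Moving a unit from [i] to [j] can only violate the constraint of a tight set containing [j] but
    not [i]. *)
Lemma transfer_base a i j : base_point a -> i != j -> 0 < a i ->
  (forall S, tight a S -> j \in S -> i \in S) -> base_point (transfer a i j).
Proof.
move=> [h T] ij ai ti.
have E S : \sum_(k in S) transfer a i j k + (i \in S) = \sum_(k in S) a k + (j \in S).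
  have one l : \sum_(k in S) (k == l : nat) = (l \in S).
    rewrite big_mkcond (bigD1 l) //= eqxx big1 ?addn0; first by case: (l \in S).
    by move=> k /negPf->; case: ifP.
  rewrite -!one -!big_split; apply: eq_bigr => k _; rewrite /= /transfer addnAC; congr (_ + _).
  by rewrite subnK //; case: eqP => // ->.
split.
  move=> S; have := E S; have := h S.
  case jS: (j \in S); case iS: (i \in S) => //=; try lia.
  have : ~~ tight a S by apply/negP => /ti/(_ jS); rewrite iS.
  rewrite /tight => ne le; rewrite addn0 addn1 => ->; by rewrite ltn_neqAle ne.
by have := E setT; rewrite !inE !sum_setT T => /addIn.
Qed.

Lemma exchange a b i : base_point a -> base_point b -> b i < a i ->
  exists j, [/\ a j < b j, base_point (transfer a i j) & base_point (transfer b j i)].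
Proof.
move=> ba bb bi.
(* [X] is the largest [a]-tight set avoiding [i], and [Y] the smallest [b]-tight set
   containing it; any [j] in [Y :\: X] with [a j < b j] does. *)
pose X := \bigcup_(S | tight a S && (i \notin S)) S.
pose Y := \bigcap_(S | tight b S && (i \in S)) S.
have tX : tight a X && (i \notin X).
  rewrite /X; elim/big_rec: _ => [|S U /andP[tS iS] /andP[tU iU]].
    by rewrite /tight big_set0 cards0 f0 inE.
  by have /andP[-> _] := tightUI ba tS tU; rewrite inE negb_or iS iU.
have tY : tight b Y && (i \in Y).
  rewrite /Y; elim/big_rec: _ => [|S U /andP[tS iS] /andP[tU iU]].
    by rewrite /tight sum_setT cardsT card_ord bb.2 eqxx inE.
  by have /andP[_ ->] := tightUI bb tS tU; rewrite inE iS iU.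
have [/andP[tX1 iX] /andP[tY1 iY]] := (tX, tY).
have [j /andP[jY /andP[jX ab]]|none] := pickP [pred j | (j \in Y) && ((j \notin X) && (a j < b j))].
  have ij : i != j by apply: contraTneq ab => <-; rewrite -leqNgt ltnW.
  exists j; split=> //.
    apply: transfer_base => //; first exact: leq_ltn_trans bi.
    move=> S tS jS; apply: contraNT jX => iS; apply/bigcupP; exists S => //.
    by rewrite tS.
  apply: transfer_base => //; first by rewrite eq_sym.
    exact: leq_ltn_trans ab.
  by move=> S tS iS; have /bigcapP := jY; apply; rewrite tS.
(* Otherwise [b <= a] on [Y :\: X], strictly at [i]. Adding tightness of [X] for [a] and of [Y] for
   [b] makes the sum of [a] over the union exceed [f #|X| + f #|Y| - f #|X :&: Y|], against
   submodularity. *)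
exfalso.
have le j : j \in Y :\: X -> b j <= a j.
  rewrite inE => /andP[jX jY]; have := none j; rewrite /= jX jY /= => /negbT.
  by rewrite -leqNgt.
have lt : \sum_(j in Y :\: X) b j < \sum_(j in Y :\: X) a j.
  rewrite (bigD1 i) /=; last by rewrite inE iX iY.
  rewrite [X in _ < X](bigD1 i) /=; last by rewrite inE iX iY.
  rewrite -addSn leq_add // leq_sum // => j /andP[jYX _]; exact: le.
have sub := f_submodular X Y.
have h1 := ba.1 (X :|: Y); have h2 := bb.1 (X :&: Y).
have EU : \sum_(j in X :|: Y) a j = \sum_(j in X) a j + \sum_(j in Y :\: X) a j.
  by rewrite (big_setID X) /= setUK setDUl setDv set0U.
have EY : \sum_(j in Y) b j = \sum_(j in X :&: Y) b j + \sum_(j in Y :\: X) b j.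
  by rewrite (big_setID X) /= setIC.
move: tX1 tY1; rewrite /tight => /eqP tX1 /eqP tY1; lia.
Qed.
End Exchange.

Lemma empty_tableaux la n f : (box la -> False) ->
  #|tableaux_of_weight la n f| = [forall l : 'I_n, f l == 0].
Proof.
move=> nob; pose T0 : {ffun box la -> 'I_n} := [ffun b => match nob b with end].
have TE T : T = T0 by apply/ffunP => b; case: (nob b).
have tT : is_tableau T0 by apply/forallP => b; case: (nob b).
have w0 l : #|[set b | T0 b == l]| = 0.
  by apply/eqP; rewrite cards_eq0; apply/eqP/setP => b; case: (nob b).
case: (boolP [forall l : 'I_n, f l == 0]) => [/forallP f0|nf0].
  apply/eqP/cards1P; exists T0; apply/setP => T; rewrite !inE (TE T) eqxx tT.
  by apply/forallP => l; rewrite w0 eq_sym.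
apply/eqP; rewrite cards_eq0; apply/eqP/setP => T; rewrite !inE (TE T) tT /=.
apply/negbTE; apply: contra nf0 => /forallP H; apply/forallP => l.
by rewrite -(eqP (H l)) w0.
Qed.

(** The encoding always has at least one row, so the empty partition is replaced by a single zero
    row. *)
Lemma partition_kt la n : is_partition la -> exists N u, [/\ strict N u,
  sumn la + tot N (staircase N) = tot N u &
  forall f, #|tableaux_of_weight la n f| = kt N n u f].
Proof.
case: la => [_|p la].
  exists 0, (fun=> 0); split=> // f.
  rewrite -card_tableaux // !empty_tableaux //.
    by move=> b; have := box_col_lt b; have := box_row_lt b; case: (box_row b).
  by move=> b; have := box_row_lt b.
set la' := p :: la => ls; exists (size la), (fun i => nth 0 la' i + (size la - i)).
have su : strict (size la) (fun i => nth 0 la' i + (size la - i)).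
  by move=> i iN; have := (sortedP 0 ls) i iN; rewrite /geq /=; lia.
split=> //.
  rewrite /tot big_split; congr (_ + _).
  by rewrite -[LHS]/(sumn la') sumnE (big_nth 0) big_mkord.
move=> f; rewrite -card_tableaux //; congr #|pred_of_set (tableaux_of_weight _ _ _)|.
apply: (@eq_from_nth _ 0) => [|i iN]; first by rewrite size_mkseq.
by rewrite nth_mkseq // addnK.
Qed.

(** The extra equation says that the partition has at most [n] nonzero parts; testing [dom] on the
    full set forces it. *)
Lemma dom_base N n u (f : nat -> nat) : dom N n u f <->
  base_point (Lam N u) (fun l : 'I_n => f l) /\ Lam N u n = Lam N u N.+1.
Proof.
have sE (S : nat -> bool) (F : 'I_n -> nat) :
    \sum_(l < n) S l * F l = \sum_(l in [set l : 'I_n | S l]) F l.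
  rewrite [RHS]big_mkcond; apply: eq_bigr => l _; rewrite inE.
  by case: (S l); rewrite ?mul1n.
have cE (S : nat -> bool) : \sum_(l < n) S l = #|[set l : 'I_n | S l]|.
  by rewrite -sum1_card -sE; apply: eq_bigr => l _; rewrite muln1.
split=> [[dS dT]|[[bS bT] LE]]; last first.
  by split=> [S|]; [rewrite sE cE; apply: bS | rewrite bT].
have LE : Lam N u n = Lam N u N.+1.
  apply/eqP; rewrite eqn_leq; apply/andP; split.
    have mono k j : Lam N u k <= Lam N u (k + j).
      by elim: j => [|j IH]; rewrite ?addn0 // addnS LamS (leq_trans IH) ?leq_addr.
    have [nN|Nn] := leqP n N.+1; first by rewrite -(subnKC nN) mono.
    by rewrite -(subnKC (ltnW Nn)) Lam_beyond.
  rewrite -dT; have := dS (fun=> true); rewrite sum1_card card_ord.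
  by congr (_ <= _); apply: eq_bigr => l _; rewrite mul1n.
split=> //; split; last by rewrite dT LE.
move=> S; pose S' (l : nat) := if insub l is Some i then i \in S else false.
have -> : S = [set l : 'I_n | S' l] by apply/setP => l; rewrite inE /S' valK.
by rewrite -sE -cE.
Qed.

Definition mnm_fun m (mu : 'X_{1..m}) (l : nat) : nat :=
  if insub l is Some i then mu i else 0.

Lemma mnm_funE m (mu : 'X_{1..m}) (l : 'I_m) : mnm_fun mu l = mu l.
Proof. by rewrite /mnm_fun valK. Qed.

Lemma mdeg_tableau_weight la m (T : {ffun box la -> 'I_m}) :
  mdeg (tableau_weight T) = sumn la.
Proof.
rewrite mdegE; under eq_bigr => i _ do rewrite mnmE -sum1dep_card big_mkcond.
rewrite exchange_big /= (eq_bigr (fun=> 1)) => [|c _]; last first.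
  by rewrite -big_mkcond (big_pred1 (T c)).
rewrite sum1_card card_tagged sumnE big_map big_enum /=.
under eq_bigr => i _ do rewrite card_ord.
by rewrite sumnE (big_nth 0) big_mkord.
Qed.

End Support.

(** * Positive eigenvalues *)

Lemma char_poly_sim (F : fieldType) n (P A D : 'M[F]_n) :
  P \in unitmx -> P *m A = D *m P -> char_poly A = char_poly D.
Proof.
rewrite unitmxE unitfE => dP PA.
have E : map_mx polyC P *m char_poly_mx A = char_poly_mx D *m map_mx polyC P.
  rewrite /char_poly_mx mulmxBr mulmxBl -!map_mxM PA; congr (_ - _).
  by rewrite scalar_mxC.
have := congr1 determinant E; rewrite !det_mulmx det_map_mx /= [RHS]mulrC.
by apply: mulfI; rewrite polyC_eq0.
Qed.

Lemma char_poly_diag_block (F : fieldType) r (a : F) (A : 'M[F]_r) :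
  char_poly (block_mx a%:M 0 0 A : 'M_(1 + r)) = ('X - a%:P) * char_poly A.
Proof.
rewrite /char_poly /char_poly_mx map_block_mx !map_mx0 (@scalar_mx_block _ 1 r).
rewrite opp_block_mx add_block_mx !oppr0 !addr0 det_lblock; congr (_ * _).
by rewrite map_scalar_mx -raddfB /= det_scalar1.
Qed.

Section Lorentz.
Variable R : realType.

Definition mxform n (A : 'M[R]_n) (x z : 'rV[R]_n) : R := (x *m A *m z^T) 0 0.

Lemma mx_sqr_gt0 n (x : 'rV[R]_n) : x != 0 -> 0 < (x *m x^T) 0 0.
Proof.
move=> x0; have [j xj] : exists j, x 0 j != 0.
  by apply/existsP; apply: contraNT x0; rewrite negb_exists => /forallP H;
     apply/eqP/rowP => j; rewrite mxE; apply/eqP; rewrite -[_ == _]negbK.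
rewrite mxE (bigD1 j) //= ltr_wpDr //.
  by apply: sumr_ge0 => k _; rewrite mxE -expr2 sqr_ge0.
by rewrite mxE -expr2 lt_def sqr_ge0 sqrf_eq0 xj.
Qed.

Lemma eigenform n (A : 'M[R]_n) x z a : x *m A = a *: x -> mxform A x z = a * (x *m z^T) 0 0.
Proof. by move=> xA; rewrite /mxform xA -scalemxAl mxE. Qed.

(** By symmetry [A] preserves the orthogonal complement of [u], so in a basis adapted to the
    splitting it becomes block diagonal. *)
Lemma orthogonal_split r (A : 'M[R]_(1 + r)) (u : 'rV_(1 + r)) (W : 'M_(r, 1 + r)) a :
  A^T = A -> u != 0 -> u *m A = a *: u -> row_free W ->
  W *m u^T = 0 -> (forall Z : 'M_(r, 1 + r), Z *m u^T = 0 -> (Z <= W)%MS) ->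
  exists A' : 'M_r, W *m A = A' *m W /\ char_poly A = ('X - a%:P) * char_poly A'.
Proof.
move=> AT u0 uA fW Wu maxW.
have : (W *m A <= W)%MS.
  apply: maxW; rewrite -mulmxA -{1}AT -trmx_mul uA linearZ /= -scalemxAr Wu.
  by rewrite scaler0.
move=> /submxP[A' WA]; exists A'; split=> //.
have uu := mx_sqr_gt0 u0.
rewrite -char_poly_diag_block; apply: (@char_poly_sim _ _ (col_mx u W)); last first.
  by rewrite mul_col_mx uA WA mul_block_col !mul0mx addr0 add0r mul_scalar_mx.
rewrite -row_free_unit; apply: inj_row_free => v.
rewrite -[v]hsubmxK mul_row_col => vP.
have v0 : lsubmx v = 0.
  have := congr1 (mulmx^~ u^T) vP; rewrite mulmxDl -!mulmxA Wu mulmx0 addr0 mul0mx.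
  rewrite [u *m _]mx11_scalar mul_mx_scalar => /eqP.
  by rewrite scaler_eq0 (gt_eqF uu) => /eqP.
move: vP; rewrite v0 mul0mx add0r -[RHS](mul0mx _ W) => /(row_free_inj fW)->.
by rewrite row_mx0.
Qed.

Lemma orthogonal_basis n (u : 'rV[R]_n) : u != 0 ->
  exists r (e : (1 + r)%N = n) (W : 'M_(r, n)), [/\ row_free W, W *m u^T = 0 &
    forall p (Z : 'M_(p, n)), Z *m u^T = 0 -> (Z <= W)%MS].
Proof.
move=> u0; exists (\rank (kermx u^T)).
have e : (1 + \rank (kermx u^T) = n)%N.
  have ru : \rank u^T = 1%N by rewrite mxrank_tr rank_rV u0.
  by rewrite mxrank_ker ru addnC subnK // -ru rank_leq_row.
exists e, (row_base (kermx u^T)); split.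
- exact: row_base_free.
- by apply/sub_kermxP; rewrite eq_row_base.
- by move=> p Z /sub_kermxP; rewrite eq_row_base.
Qed.

(** Once one positive eigenvalue is split off, a second one, even an equal one, would have an
    eigenvector orthogonal to the first, and the inequality would bound a positive product by
    zero. *)
Lemma num_pos_eigenvalues_le1 n (A : 'M[R]_n) : A^T = A ->
  (forall x z, 0 < mxform A x x -> mxform A x x * mxform A z z <= mxform A x z ^+ 2) ->
  (num_pos_eigenvalues A <= 1)%N.
Proof.
move=> AT HA; rewrite /num_pos_eigenvalues.
have [/hasP[a ra a0]|nh] := boolP (has (fun a => 0 < a) (rootsR (char_poly A))); last first.
  by rewrite big_hasC.
have cA0 : char_poly A != 0 by apply: monic_neq0; apply: char_poly_monic.
have {}ra : root (char_poly A) a by have := roots_on_rootsR cA0 a; rewrite inE /= ra.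
have /eigenvalueP[u uA u0] : eigenvalue A a by rewrite eigenvalue_root_char.
have [r [e [W [fW Wu maxW]]]] := orthogonal_basis u0.
subst n.
have [A' [WA cA]] := orthogonal_split AT u0 uA fW Wu (maxW r).
have nroot b : 0 < b -> ~~ root (char_poly A') b.
  move=> b0; apply/negP; rewrite -eigenvalue_root_char => /eigenvalueP[x xA x0].
  pose w := x *m W.
  have w0 : w != 0.
    by apply: contra x0 => /eqP; rewrite /w -[RHS](mul0mx _ W) => /(row_free_inj fW)->.
  have wA : w *m A = b *: w by rewrite /w -mulmxA WA mulmxA xA scalemxAl.
  have := HA u w; rewrite !(eigenform _ uA) (eigenform _ wA).
  have -> : u *m w^T = 0 by rewrite -[LHS]trmxK trmx_mul trmxK /w -mulmxA Wu mulmx0 trmx0.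
  have uu := mx_sqr_gt0 u0; have ww := mx_sqr_gt0 w0.
  have -> : (0 : 'M[R]_1) 0 0 = 0 by rewrite mxE.
  rewrite mulr0 expr0n /= => /(_ (mulr_gt0 a0 uu)).
  by rewrite leNgt !mulr_gt0.
have cA'0 : char_poly A' != 0 by apply: monic_neq0; apply: char_poly_monic.
have mE b : 0 < b -> mup b (char_poly A) = (b == a).
  by move=> b0; rewrite cA mupMl ?nroot // -['X - _]expr1 mup_XsubCX eq_sym; case: eqP.
rewrite (eq_bigr (fun b => (b == a) : nat)); last by move=> b; apply: mE.
apply: (@leq_trans (\sum_(b <- rootsR (char_poly A)) (b == a))%N).
  by rewrite big_mkcond leq_sum // => b _; case: ifP.
rewrite (_ : (\sum_(b <- _) _)%N = count_mem a (rootsR (char_poly A))).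
  by rewrite count_uniq_mem ?leq_b1 // uniq_roots.
by rewrite -sum1_count [RHS]big_mkcond; apply: eq_bigr => b _; rewrite /=; case: (b == a).
Qed.
End Lorentz.

(** * The Schur polynomial *)

Section Schur.
Variables (R : realType) (m : nat).

Lemma mcoeff_schur la (mu : 'X_{1..m}) (f : nat -> nat) : (forall l : 'I_m, f l = mu l) ->
  (schur R m la)@_mu = #|tableaux_of_weight la m f|%:R.
Proof.
move=> fE; rewrite /schur raddf_sum /= -sum1_card natr_sum.
rewrite big_mkcond [RHS]big_mkcond; apply: eq_bigr => T _; rewrite inE mcoeffX.
case: (is_tableau T) => //=.
have -> : (tableau_weight T == mu) = [forall l : 'I_m, #|[set b | T b == l]| == f l].
  apply/eqP/forallP => [wE l|H]; first by rewrite fE -wE mnmE.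
  by apply/mnmP => l; rewrite mnmE -fE; apply/eqP.
by case: [forall l, _].
Qed.

Lemma mnm_factU (mu : 'X_{1..m}) i : mnm_fact (mu + U_(i))%MM = ((mu i).+1 * mnm_fact mu)%N.
Proof.
rewrite /mnm_fact (bigD1 i) //= [in RHS](bigD1 i) //= mulnA; congr (_ * _)%N.
  by rewrite mnmDE mnm1E eqxx addn1 factS.
by apply: eq_bigr => j ji; rewrite mnmDE mnm1E eq_sym (negPf ji) addn0.
Qed.

Lemma mnm_fact_gt0 (mu : 'X_{1..m}) : (0 < mnm_fact mu)%N.
Proof. by apply: prodn_gt0 => i; apply: fact_gt0. Qed.

(** On the divided powers x^mu / mu! differentiation merely shifts exponents; this is the role of
    the normalization. *)
Lemma mcoeff_iter_deriv s (p : {mpoly R[m]}) mu :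
  (iter_deriv s (normalize p))@_mu = p@_(mu + \big[mnm_add/0%MM]_(i <- s) U_(i))%MM / (mnm_fact mu)%:R.
Proof.
elim: s mu => [|i s IH] mu; first by rewrite big_nil addm0 mcoeff_normalize.
rewrite /= mcoeff_mderiv IH big_cons addmA mnm_factU natrM -mulr_natr.
field.
by rewrite nat1r !pnatr_eq0 -lt0n mnm_fact_gt0.
Qed.

Lemma mem_support_schur la mu N u : (forall f, #|tableaux_of_weight la m f| = kt N m u f) ->
  strict N u -> mu \in msupp (normalize (schur R m la)) <-> dom N m u (mnm_fun mu).
Proof.
move=> E su; rewrite mcoeff_msupp mcoeff_normalize (@mcoeff_schur _ _ (mnm_fun mu)); last exact: mnm_funE.
rewrite E mulf_eq0 negb_or invr_eq0 !pnatr_eq0 -!lt0n mnm_fact_gt0 andbT.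
exact: kt_dom.
Qed.

Lemma normalize_schur_homog la : normalize (schur R m la) \is (sumn la).-homog.
Proof.
apply/dhomogP => mu; rewrite mcoeff_msupp mcoeff_normalize (@mcoeff_schur _ _ (mnm_fun mu)); last exact: mnm_funE.
rewrite mulf_eq0 negb_or pnatr_eq0 cards_eq0 => /andP[/set0Pn[T]].
rewrite inE => /andP[_ /forallP H] _; rewrite -(mdeg_tableau_weight T).
by congr mdeg; apply/mnmP => l; rewrite mnmE (eqP (H l)) mnm_funE.
Qed.

Lemma normalize_schur_ge0 la mu : 0 <= (normalize (schur R m la))@_mu.
Proof.
rewrite mcoeff_normalize (@mcoeff_schur _ _ (mnm_fun mu)); last exact: mnm_funE.
by rewrite divr_ge0 ?ler0n.
Qed.

Lemma normalize_schur_M_convex la : is_partition la ->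
  M_convex (support_set (normalize (schur R m la))).
Proof.
move=> /(partition_kt m)[N [u [su _ E]]] i _ _ [a ha ->] [b hb ->]; rewrite !mxE ltz_nat => ab.
have [ba LE] := (dom_base _ _ _ _).1 ((mem_support_schur _ E su).1 ha).
have [bb _] := (dom_base _ _ _ _).1 ((mem_support_schur _ E su).1 hb).
have [|||j [ab' ma mb]] := @exchange m (Lam N u) _ _ _ _ i ba bb.
- by rewrite /Lam big_ord0.
- by move=> x c d; apply: Lam_concave.
- by rewrite !mnm_funE.
have vecE (c : 'X_{1..m}) k l : (0 < c k)%N -> base_point (Lam N u) (transfer (fun l : 'I_m => mnm_fun c l) k l) ->
   support_set (normalize (schur R m la)) (\row_i (c i)%:Z - unit_vec k + unit_vec l).
  move=> ck bm; exists [multinom transfer (fun l : 'I_m => mnm_fun c l) k l t | t < m].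
    apply/(mem_support_schur _ E su)/dom_base; split=> //.
    case: bm => b1 b2; split.
      by move=> S; rewrite (eq_bigr (transfer (fun l : 'I_m => mnm_fun c l) k l)) // => t _; rewrite mnm_funE mnmE.
    by rewrite -b2; apply: eq_bigr => t _; rewrite mnm_funE mnmE.
  apply/rowP => t; rewrite !mxE /= mnmE /transfer mnm_funE.
  (* The truncated subtraction in [transfer] agrees with subtraction in the integers, since [c k] is
     positive. *)
  have : ((t == k) <= c t)%N by case: eqP => // ->.
  by case: (t == k); case: (t == l) => /=; lia.
exists j; rewrite !mxE ltz_nat; split.
- by move: ab'; rewrite !mnm_funE.
- by apply: vecE ma; apply: leq_ltn_trans ab.
- by apply: vecE mb; apply: leq_ltn_trans (_ : a j < b j)%N => //; move: ab'; rewrite !mnm_funE.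
Qed.

Lemma normalize_schur_eigen la s : is_partition la -> (size s).+2 = sumn la ->
  (num_pos_eigenvalues (form_matrix (iter_deriv s (normalize (schur R m la)))) <= 1)%N.
Proof.
move=> /(partition_kt m)[N [u [su tE E]]] sE.
pose nu := \big[mnm_add/0%MM]_(i <- s) U_(i)%MM : 'X_{1..m}.
have nuE : (\sum_(l < m) mnm_fun nu l)%N = size s.
  under eq_bigr => l _ do rewrite mnm_funE.
  by rewrite -mdegE /nu mdeg_sum (eq_bigr (fun=> 1%N)) ?sum1_size // => i _; rewrite mdeg1.
set A := form_matrix _.
have AE i j : A i j = (kt N m u (bump2 (mnm_fun nu) i j))%:R / 2.
  rewrite mxE; congr (_ / _).
  have := mcoeff_iter_deriv [:: j, i & s] (schur R m la) 0%MM => /= ->.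
  rewrite add0m !big_cons -/nu (@mcoeff_schur _ _ (bump2 (mnm_fun nu) i j)) => [|l].
    rewrite E /mnm_fact big1 ?divr1 // => k _; by rewrite mnmE.
  by rewrite /bump2 !mnmDE !mnm1E mnm_funE -!val_eqE /= ![_ == l :> nat]eq_sym; lia.
have AF x z : mxform A x z = 2^-1 * kostka_form N u (mnm_fun nu) (fun i => x 0 i) (fun i => z 0 i).
  rewrite /mxform /kostka_form mxE exchange_big mulr_sumr /=; apply: eq_bigr => j _.
  rewrite mxE mulr_suml mulr_sumr; apply: eq_bigr => i _; rewrite AE mxE; ring.
apply: num_pos_eigenvalues_le1 => [|x z].
  apply/matrixP => i j; rewrite mxE !AE; congr (_%:R / _).
  rewrite -!E; congr #|pred_of_set _|; apply/setP => T; rewrite !inE; congr (_ && _).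
  by apply: eq_forallb => l; rewrite /bump2 addnAC.
rewrite !AF => Qx; have Q0 : 0 < kostka_form N u (mnm_fun nu) (fun i => x 0 i) (fun i => x 0 i).
  by move: Qx; rewrite pmulr_rgt0 // invr_gt0 ltr0n.
have := kostka_form_hodge (fun i => z 0 i) su _ Q0; rewrite nuE sE => /(_ tE).
by nra.
Qed.
End Schur.

Theorem theorem3 (R : realType) (m : nat) (la : seq nat) (hla : is_partition la) :
  lorentzian (sumn la) (normalize (schur R m la)).
Proof.
split.
- exact: normalize_schur_homog.
- exact: normalize_schur_ge0.
- exact: normalize_schur_M_convex.
- by move=> s; apply: normalize_schur_eigen.
Qed.
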